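(* Let $P$ be the unit square with vertices $0,-i,1-i,1$, and let $\boldsymbol{\lambda}=(\lambda,\lambda,\lambda,\lambda)$ with $\lambda\in(0,1)\setminus\Lambda$. Then for every $\epsilon>0$ there exists $\delta>0$ such that if $(P',\boldsymbol{\lambda}')\in\mathcal{P}_4$ and $\|(P',\boldsymbol{\lambda}')-(P,\boldsymbol{\lambda})\|<\delta$, then (1) $T_{P',\boldsymbol{\lambda}'}$ is asymptotically periodic; (2) $\operatorname{card}(\omega(T_{P',\boldsymbol{\lambda}'}))=\operatorname{card}(\omega(T_{P,\boldsymbol{\lambda}}))$; (3) the Hausdorff distance of $\omega(T_{P',\boldsymbol{\lambda}'})$ and $\omega(T_{P,\boldsymbol{\lambda}})$ is less than $\epsilon$; (4) corresponding periodic orbits of $T_{P',\boldsymbol{\lambda}'}$ and $T_{P,\boldsymbol{\lambda}}$ have the same period (i.e. there is a bijection between the periodic orbits of the two maps preserving periods).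
   Context: Let $P\subset\mathbb{C}$ be a (closed) convex $k$-gon with vertices $w_1,\ldots,w_k$ in counterclockwise order (indices mod $k$) and $\boldsymbol{\lambda}=(\lambda_1,\ldots,\lambda_k)\in(0,1)^k$. Let $X=\mathbb{C}\setminus P$ and $A_i=\{w_i+x(w_{i-1}-w_i)+y(w_i-w_{i+1}) : x,y>0\}$; these are disjoint open cones in $X$. The dissipative outer billiard map is $T_{P,\boldsymbol{\lambda}}(z)=-\lambda_iz+(1+\lambda_i)w_i$ for $z\in A_i$; it is not defined on the singular set $\mathcal{S}=X\setminus\bigcup_iA_i$. A point $z\in X$ is non-singular if its forward orbit never meets $\mathcal{S}$. $\omega(T_{P,\boldsymbol{\lambda}})$ denotes the union of the $\omega$-limit sets of all non-singular points. $T_{P,\boldsymbol{\lambda}}$ is asymptotically periodic if $\omega(T_{P,\boldsymbol{\lambda}})$ is the union of finitely many periodic orbits and the forward orbit of every non-singular point converges to one of them. $\mathcal{P}_k$ is the collection of pairs $(P,\boldsymbol{\lambda})$, where $P$ is a convex $k$-gon with no more than two vertices on the same side and one vertex at the origin, and $\boldsymbol{\lambda}\in(0,1)^k$. Labelling the vertices counterclockwise so that $w_k=0$ and $w_1$ follows the vertex at the origin, $P$ is identified with $(w_1,\ldots,w_{k-1})\in\mathbb{R}^{2k-2}$, so that $\mathcal{P}_k$ is an open subset of $\mathbb{R}^{3k-2}$, with metric given by the sup norm $\|\cdot\|$. $\Lambda=\{\lambda_1,\lambda_2,\ldots\}$, where in this set $\lambda_n$ ($n\ge1$) denotes the unique root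 in $[0,1)$ of $x^{2n}-x^n-x^{n-1}+1$. *)

(* Defs.v *)
From HB Require Import structures.
From mathcomp Require Import all_boot all_order all_algebra.
From mathcomp Require Import complex.
From mathcomp Require Import all_classical all_reals all_analysis.

Set Implicit Arguments.
Unset Strict Implicit.
Unset Printing Implicit Defensive.

Import Order.TTheory GRing.Theory Num.Theory.
Import numFieldNormedType.Exports.

Local Open Scope classical_set_scope.
Local Open Scope ring_scope.
Local Open Scope complex_scope.

(** The vertices of a k-gon are a function [w : 'I_k -> R[i]], the indices
    being residues mod k: [ordS] and [ord_pred] are the cyclic successor and
    predecessor, and index 0 plays the role of index k, i.e. w_k is [w 0]. *)

Definition polygon (R : realType) (k : nat) (w : 'I_k -> R[i]) : set R[i] :=
  [set z | exists t : 'I_k -> R,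
     [/\ forall i, 0 <= t i, \sum_i t i = 1 & z = \sum_i (t i)%:C * w i]].

Definition det2 (R : realType) (u v : R[i]) : R :=
  complex.Re u * complex.Im v - complex.Im u * complex.Re v.

(** Every vertex other than the two ends of the edge from [w i] to
    [w (ordS i)] lies strictly to the left of that edge.  This says at once
    that the polygon is convex, that its vertices are listed counterclockwise,
    and (strictness) that no side contains more than two of them. *)
Definition convex_ccw (R : realType) (k : nat) (w : 'I_k -> R[i]) : Prop :=
  (3 <= k)%N /\
  forall i j : 'I_k, j != i -> j != ordS i ->
    0 < det2 (w (ordS i) - w i) (w j - w i).

Definition exterior (R : realType) (k : nat) (w : 'I_k -> R[i]) : set R[i] :=
  ~` polygon w.

Definition cone (R : realType) (k : nat) (w : 'I_k -> R[i]) (i : 'I_k) :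
    set R[i] :=
  [set z | exists x y : R, [/\ 0 < x, 0 < y &
     z = w i + x%:C * (w (ord_pred i) - w i) + y%:C * (w i - w (ordS i))]].

Definition singular_set (R : realType) (k : nat) (w : 'I_k -> R[i]) :
    set R[i] :=
  exterior w `\` \bigcup_(i in [set: 'I_k]) cone w i.

(** For a convex polygon the cones are pairwise disjoint, so [pick] finds the
    only candidate.  The map is partial: the value [z] returned outside the
    cones is a dummy, and all the notions below only iterate the map along
    orbits of non-singular points, which never leave the cones. *)
Definition billiard (R : realType) (k : nat) (w : 'I_k -> R[i])
    (lam : 'I_k -> R) (z : R[i]) : R[i] :=
  if [pick i | `[< cone w i z >]] is Some i
  then - (lam i)%:C * z + (1 + lam i)%:C * w i
  else z.

Definition nonsingular (R : realType) (k : nat) (w : 'I_k -> R[i])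
    (lam : 'I_k -> R) : set R[i] :=
  [set z | exterior w z /\
           forall n, ~ singular_set w (iter n (billiard w lam) z)].

(** The annotation [R[i]^o] only selects the topology of the norm of [R[i]]. *)
Definition omega_limit (R : realType) (k : nat) (w : 'I_k -> R[i])
    (lam : 'I_k -> R) (z : R[i]) : set R[i] :=
  cluster ((iter n (billiard w lam) z : R[i]^o) @[n --> \oo]).

Definition omega (R : realType) (k : nat) (w : 'I_k -> R[i])
    (lam : 'I_k -> R) : set R[i] :=
  \bigcup_(z in nonsingular w lam) omega_limit w lam z.

Definition forward_orbit (R : realType) (k : nat) (w : 'I_k -> R[i])
    (lam : 'I_k -> R) (z : R[i]) : set R[i] :=
  [set iter n (billiard w lam) z | n in [set: nat]].

Definition minimal_period (R : realType) (k : nat) (w : 'I_k -> R[i])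
    (lam : 'I_k -> R) (z : R[i]) (p : nat) : Prop :=
  [/\ (0 < p)%N, iter p (billiard w lam) z = z &
      forall q, (0 < q < p)%N -> iter q (billiard w lam) z <> z].

Definition orbit_of_period (R : realType) (k : nat) (w : 'I_k -> R[i])
    (lam : 'I_k -> R) (p : nat) : set (set R[i]) :=
  [set O | exists z, [/\ nonsingular w lam z, minimal_period w lam z p &
                         O = forward_orbit w lam z]].

Definition periodic_orbits (R : realType) (k : nat) (w : 'I_k -> R[i])
    (lam : 'I_k -> R) : set (set R[i]) :=
  \bigcup_(p in [set: nat]) orbit_of_period w lam p.

Definition dist_to_set (R : realType) (A : set R[i]) (z : R[i]) : \bar R :=
  ereal_inf [set (Normc.normc (z - a))%:E | a in A].

Definition hausdorff_dist (R : realType) (A B : set R[i]) : \bar R :=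
  maxe (ereal_sup [set dist_to_set B a | a in A])
       (ereal_sup [set dist_to_set A b | b in B]).

Definition asymptotically_periodic (R : realType) (k : nat)
    (w : 'I_k -> R[i]) (lam : 'I_k -> R) : Prop :=
  exists F : set (set R[i]),
    [/\ finite_set F, F `<=` periodic_orbits w lam,
        omega w lam = \bigcup_(O in F) O &
        forall z, nonsingular w lam z -> exists2 O, F O &
          dist_to_set O (iter n (billiard w lam) z) @[n --> \oo] --> 0%E].

(** [P_space w lam] is membership of (P, lambda) in P_k, for k = m.+1. *)
Definition P_space (R : realType) (m : nat) (w : 'I_m.+1 -> R[i])
    (lam : 'I_m.+1 -> R) : Prop :=
  [/\ convex_ccw w, w ord0 = 0 & forall i, 0 < lam i < 1].

(** Coordinates of (P, lambda) in R^(3k-2), k = m.+1: the vertex at the origin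
    is omitted.  The norm of ['rV[R]_n] is the sup norm. *)
Definition coords (R : realType) (m : nat) (w : 'I_m.+1 -> R[i])
    (lam : 'I_m.+1 -> R) : 'rV[R]_(m + m + m.+1) :=
  row_mx (row_mx (\row_j complex.Re (w (lift ord0 j)))
                 (\row_j complex.Im (w (lift ord0 j))))
         (\row_j lam j).

(** For each n >= 1 the polynomial has exactly one root in [0, 1), so this is
    the set of the lambda_n. *)
Definition Lambda (R : realType) : set R :=
  [set x | exists2 n : nat, (1 <= n)%N &
     0 <= x < 1 /\ x ^+ (2 * n) - x ^+ n - x ^+ n.-1 + 1 = 0].

(** w_4 = 0 (index 0), w_1 = -i, w_2 = 1 - i, w_3 = 1. *)
Definition unit_square (R : realType) : 'I_4 -> R[i] :=
  tnth [tuple 0; - 'i; 1 - 'i; 1].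

(* Main.v *)
Require Import Defs.
From HB Require Import structures.
From mathcomp Require Import all_boot all_order all_algebra.
From mathcomp Require Import complex.
From mathcomp Require Import all_classical all_reals all_analysis.
From mathcomp Require Import ring lra zify.
Import Order.TTheory GRing.Theory Num.Theory.
Import numFieldNormedType.Exports.

(** The map contracts, and on each cone it is a fixed affine map, so an orbit is
    governed by the sequence of vertices it is reflected in. For the square, the
    four-fold symmetry reduces the dynamics to the first quadrant, where a step
    is a -> 1 - l b, b -> l a when the image lies in the next cone, and
    a -> 1 + l a, b -> l b - 1 when it lies in the opposite one. A step to the
    opposite cone lowers b by at least 1, so steps to the next cone recur; right
    after such a step the abscissa is at most 1, and this forces the number m of
    steps to the opposite cone between two consecutive steps to the next one
    never to increase ([quadrant_itinerary]). Hence m is eventually constant,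
    and the orbit converges to the cycle of the affine maps with that pattern.
    That cycle lies in the closed quadrant exactly when
    l^(2n) - l^n - l^(n-1) + 1 <= 0 with n = m + 1 ([quadrant_cycle_last]);
    outside the exceptional set equality never occurs, and since these values
    tend to 1 they are bounded away from 0 by some c uniformly in m
    ([gap_bounded_away]).

    Every step of this argument tolerates an error: it still works for orbits
    whose coordinates are only at least - k, for a small k
    ([quadrant_orbit_settles]). An orbit of a nearby polygon is eventually
    bounded, and the orbit of the unperturbed affine maps along the same
    vertices stays close to it, because a contraction sums the errors to a
    geometric series ([vertex_orbit_shadow]). So the vertices visited in the
    perturbed system also settle on one of the patterns with a negative
    polynomial ([nonsingular_settles]). Conversely, for such a pattern the
    perturbed affine cycle is close to the unperturbed one, which lies inside
    the cones with a margin c / 2; so it is a true periodic orbit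
    ([vertex_cycle_cone]).

    Both systems are thus described by nearby cycles, indexed by the same
    finite set of patterns, of periods 4 (m + 1) ([near_square_cycle_system]),
    and all the conclusions are read off this description ([cycle_system]). *)

Set Implicit Arguments.
Unset Strict Implicit.
Unset Printing Implicit Defensive.

Local Open Scope classical_set_scope.
Local Open Scope ring_scope.
Local Open Scope complex_scope.

(** * Scalar contracting recursions *)

Lemma expr_eventually_lt (R : realType) (rho e : R) :
  0 <= rho < 1 -> 0 < e ->
  exists N : nat, forall n, (N <= n)%N -> rho ^+ n < e.
Proof.
move=> /andP[r0 r1] e0.
have := @cvg_expr R rho; rewrite ger0_norm // => /(_ r1) /cvgrPdist_lt /(_ e e0).
case=> N _ HN; exists N => n Nn.
by have := HN n Nn; rewrite sub0r normrN ger0_norm ?exprn_ge0.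
Qed.

(** Applied to the size of an orbit it gives boundedness, to the distance of two
    orbits of nearby maps it gives shadowing, and with e = 0 convergence. *)
Lemma recursion_eventually_le (R : realType) (rho e t : R) (u : nat -> R)
    (N0 : nat) :
  0 <= rho < 1 -> e < (1 - rho) * t ->
  (forall n, (N0 <= n)%N -> u n.+1 <= rho * u n + e) ->
  exists N, forall n, (N <= n)%N -> u n <= t.
Proof.
move=> /[dup] rho01 /andP[r0 r1] et Hu.
pose q := e / (1 - rho).
have r1' : 0 < 1 - rho by lra.
have eq_e : e = q * (1 - rho) by rewrite /q; field; lra.
have qt : q < t by rewrite /q ltr_pdivrMr // mulrC.
have Hk k : u (N0 + k)%N - q <= rho ^+ k * (u N0 - q).
  elim: k => [|k IH]; first by rewrite addn0 expr0 mul1r.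
  rewrite addnS; have := Hu (N0 + k)%N (leq_addr _ _).
  have := ler_wpM2l r0 IH.
  rewrite mulrA -exprS eq_e => h1 h2; nra.
pose D := `|u N0 - q| + 1.
have D0 : 0 < D by rewrite /D; have := normr_ge0 (u N0 - q); lra.
have tq : 0 < t - q by rewrite subr_gt0.
have [N HN] := expr_eventually_lt rho01 (divr_gt0 tq D0).
exists (N0 + N)%N => n Nn.
have -> : n = (N0 + (n - N0))%N by lia.
have /HN : (N <= n - N0)%N by lia.
rewrite ltr_pdivlMr ?subr_gt0 // => hlt.
have h1 := Hk (n - N0)%N.
have h2 : rho ^+ (n - N0) * (u N0 - q) <= rho ^+ (n - N0) * D.
  by rewrite ler_wpM2l ?exprn_ge0 // /D; have := ler_norm (u N0 - q); lra.
lra.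
Qed.

Fixpoint affine_orbit (R : realType) (al be : nat -> R) (x : R) (n : nat) : R :=
  if n is n'.+1 then al n' * affine_orbit al be x n' + be n' else x.

Lemma affine_orbitE (R : realType) (al be : nat -> R) (x : R) n :
  affine_orbit al be x n =
  (\prod_(i < n) al i) * x + affine_orbit al be 0 n.
Proof.
elim: n => [|n IH] /=; first by rewrite big_ord0; ring.
by rewrite big_ord_recr /= IH; ring.
Qed.

(** The first return of a periodic affine recursion is itself an affine
    contraction, so that it has a fixed point. *)
Lemma periodic_affine_orbit (R : realType) (rho : R) (al be : nat -> R) P :
  0 <= rho < 1 -> (0 < P)%N -> (forall n, `|al n| <= rho) ->
  (forall n, al (n + P)%N = al n) -> (forall n, be (n + P)%N = be n) ->
  exists x : nat -> R, (forall n, x n.+1 = al n * x n + be n) /\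
    (forall n, x (n + P)%N = x n).
Proof.
move=> /andP[r0 r1] P0 Hal alP beP.
pose A := \prod_(i < P) al i.
have A1 : `|A| < 1.
  rewrite /A normr_prod (@le_lt_trans _ _ (\prod_(i < P) rho)) //.
    by apply: ler_prod => i _; rewrite normr_ge0 Hal.
  by rewrite prodr_const card_ord exprn_ilt1 // -lt0n.
have nA : 1 - A != 0 by move: A1; rewrite ltr_norml => ?; lra.
pose x0 := affine_orbit al be 0 P / (1 - A).
exists (affine_orbit al be x0); split=> // n.
elim: n => [|n IH].
  by rewrite add0n affine_orbitE -/A /= /x0; field.
by rewrite addSn /= IH alP beP.
Qed.

(** * The first-quadrant model of the square *)

(** One step of the billiard of the square, in the coordinates of each cone
    with respect to its sides; [s] tells whether the image lies in the next
    cone or in the opposite one. *)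
Definition quadrant_map (R : realType) (l : R) (s : bool) (p : R * R) : R * R :=
  if s then (1 - l * p.2, l * p.1) else (1 + l * p.1, l * p.2 - 1).

Definition geom (R : realType) (l : R) (n : nat) : R := (1 - l ^+ n) / (1 - l).

Lemma geom0 (R : realType) (l : R) : geom l 0 = 0.
Proof. by rewrite /geom expr0 subrr mul0r. Qed.

Lemma geomS (R : realType) (l : R) n : l < 1 -> geom l n.+1 = 1 + l * geom l n.
Proof. by move=> l1; rewrite /geom exprS; field; lra. Qed.

Lemma geom_ge0 (R : realType) (l : R) n : 0 < l < 1 -> 0 <= geom l n.
Proof.
move=> /andP[l0 l1]; apply: divr_ge0; last by lra.
by rewrite subr_ge0 exprn_ile1 // ltW.
Qed.

Lemma geomS_ge1 (R : realType) (l : R) n : 0 < l < 1 -> 1 <= geom l n.+1.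
Proof.
move=> /[dup] l01 /andP[l0 l1]; rewrite geomS //.
by have := geom_ge0 n l01; nra.
Qed.

Lemma dvdSn_modn m n : (m.+1 %| n.+1)%N = (n %% m.+1 == m)%N.
Proof.
rewrite /dvdn -addn1 -modnDml.
have := ltn_pmod n (ltn0Sn m); rewrite ltnS leq_eqVlt => /orP[/eqP->|lt].
  by rewrite addn1 modnn !eqxx.
by rewrite modn_small; lia.
Qed.

(** The tolerance [k] absorbs the distance between an orbit of a perturbed
    polygon and its shadow. *)
Section QuadrantOrbit.
Variables (R : realType) (l k : R) (s : nat -> bool) (p : nat -> R * R).
Hypotheses (l01 : 0 < l < 1) (k0 : 0 < k) (kl : 2 * k < 1 - l ^+ 2).
Hypothesis orbit : forall n, p n.+1 = quadrant_map l (s n) (p n).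
Hypothesis quadrant : forall n, - k <= (p n).1 /\ - k <= (p n).2.

Let block t m :=
  [/\ s t, forall j, (j < m)%N -> ~~ s (t.+1 + j)%N & s (t.+1 + m)%N].

Let opp_run t m :
  (forall j, (j < m)%N -> ~~ s (t + j)%N) ->
  p (t + m)%N = (l ^+ m * (p t).1 + geom l m, l ^+ m * (p t).2 - geom l m).
Proof.
have l1 : l < 1 by case/andP: l01.
elim: m => [|m IH] H.
  by rewrite addn0 expr0 geom0 !mul1r addr0 subr0 -surjective_pairing.
rewrite addnS orbit IH => [|j jm]; last by apply: H; lia.
rewrite /quadrant_map (negbTE (H m _)) //= geomS // exprS.
by congr pair; ring.
Qed.

Let next_exists t : exists j, s (t + j)%N.
Proof.
move: (l01) (k0) => /andP[l0 l1] k_gt0.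
apply/not_existsP => H.
have run m : p (t + m)%N =
    (l ^+ m * (p t).1 + geom l m, l ^+ m * (p t).2 - geom l m).
  by apply: opp_run => j _; apply/negP/H.
have k1 : k < 1 / 2 by have := kl; have := exprn_gt0 2 l0; lra.
have desc m : (p (t + m)%N).2 <= (p t).2 - m%:R * (1 / 2).
  elim: m => [|m IH]; first by rewrite addn0; lra.
  have := H (t + m)%N; rewrite addnS orbit /quadrant_map => _.
  have -> /= : s (t + m)%N = false by apply/negbTE/negP/H.
  have [_ hb] := quadrant (t + m)%N; rewrite -natr1.
  have : 0 <= (1 - l) * ((p (t + m)%N).2 + k) by apply: mulr_ge0; lra.
  nra.
(* The ordinate would have dropped below -1 after m steps. *)
pose m := (Num.truncn (2 * ((p t).2 + 1))).+1.
have hm : 2 * ((p t).2 + 1) < m%:R by apply: truncnS_gt.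
have := desc m; have [_] := quadrant (t + m)%N; lra.
Qed.

Let block_exists t : s t -> exists m, block t m.
Proof.
move=> st; case: (ex_minnP (next_exists t.+1)) => m sm min.
by exists m; split=> // j jm; apply/negP => /min; lia.
Qed.

(** The abscissa after a step to the next cone is at most 1 + k, so it is at
    most geom (m + 1) + k at the end of the block; the next block starts with
    l times this as its ordinate, which m + 1 steps to the opposite cone would
    bring below - k. *)
Let block_le t m m' : block t m -> block (t.+1 + m)%N m' -> (m' <= m)%N.
Proof.
move=> [st Hm sm] [_ Hm' _]; rewrite leqNgt; apply/negP => mm'.
move: (l01) (k0) (kl) => /andP[l0 l1] k_gt0 k_small.
have E : p t.+1 = (1 - l * (p t).2, l * (p t).1) by rewrite orbit st.
have ea : (p t.+1).1 <= 1 + k.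
  by rewrite E /=; have [_] := quadrant t; nra.
have E2 := opp_run Hm.
have E3 : p (t.+1 + m).+1 = (1 - l * (p (t.+1 + m)%N).2, l * (p (t.+1 + m)%N).1).
  by rewrite orbit sm.
have E4 : p ((t.+1 + m).+1 + m.+1)%N =
    (l ^+ m.+1 * (p (t.+1 + m).+1).1 + geom l m.+1,
     l ^+ m.+1 * (p (t.+1 + m).+1).2 - geom l m.+1).
  by apply: opp_run => j jm; apply: Hm'; lia.
have [_] := quadrant ((t.+1 + m).+1 + m.+1)%N.
rewrite E4 /= E3 /= E2 /=.
have x0 : 0 <= l ^+ m by apply: exprn_ge0; exact: ltW.
have x1 : l ^+ m <= 1 by apply: exprn_ile1; exact: ltW.
have g1 := geomS_ge1 m l01.
have gE : l ^+ m + geom l m = geom l m.+1.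
  by rewrite /geom exprS; field; lra.
have le1 : l ^+ m * (p t.+1).1 + geom l m <= geom l m.+1 + k.
  by rewrite -gE; nra.
move: le1; set X := l ^+ m * _ + _ => le1.
have y1 : l ^+ m.+1 <= l by rewrite exprS; nra.
have y0 : 0 <= l ^+ m.+1 by apply: exprn_ge0; exact: ltW.
have : l ^+ m.+1 * (l * X) <= l ^+ m.+1 * (l * (geom l m.+1 + k)).
  by apply: ler_wpM2l => //; apply: ler_wpM2l => //; exact: ltW.
have : l ^+ m.+1 * (l * (geom l m.+1 + k)) <= l * (l * (geom l m.+1 + k)).
  by apply: ler_wpM2r => //; nra.
nra.
Qed.

Let block_eventually_const m t : block t m ->
  exists m' N, forall q, block (N + q * m'.+1)%N m'.
Proof.
elim/ltn_ind: m t => m IH t bt.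
have [H|] := pselect (forall q, block (t + q * m.+1)%N m).
  by exists m, t.
move/existsNP => exq.
have exq' : exists q, ~~ `[< block (t + q * m.+1)%N m >].
  by case: exq => q /asboolPn; exists q.
case: (ex_minnP exq') => -[|q] /asboolPn nb min.
  by exfalso; apply: nb; rewrite mul0n addn0.
have bq : block (t + q * m.+1)%N m.
  by apply/asboolP; apply: contraT => /min; rewrite ltnn.
have e : (t + q.+1 * m.+1 = (t + q * m.+1).+1 + m)%N by lia.
move: nb; rewrite e => nb.
have [_ _ /block_exists[m' bm']] := bq.
have := block_le bq bm'; rewrite leq_eqVlt => /orP[/eqP em|lm].
  by exfalso; apply: nb; rewrite -em in bm' *.
exact: IH bm'.
Qed.

Lemma quadrant_itinerary :
  exists m N, forall n, s (N + n)%N = (m.+1 %| n.+1)%N.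
Proof.
have [j sj] := next_exists 0.
have [m /block_eventually_const[m' [N H]]] := block_exists sj.
exists m', N.+1 => n.
have [_ H1 H2] := H (n %/ m'.+1)%N.
have e : (N.+1 + n = (N + n %/ m'.+1 * m'.+1).+1 + n %% m'.+1)%N.
  by rewrite {1}(divn_eq n m'.+1); lia.
rewrite e dvdSn_modn; case: eqP => [->|ne]; first exact: H2.
apply/negbTE/H1; have := ltn_pmod n (ltn0Sn m'); lia.
Qed.

End QuadrantOrbit.

(** * The cycles of the first-quadrant model *)

(** The polynomial of the exceptional parameters, of index n = m + 1. *)
Definition gap (R : realType) (l : R) (m : nat) : R :=
  l ^+ (2 * m.+1) - l ^+ m.+1 - l ^+ m + 1.

(** The fixed point of the return map from one step to the next cone to the
    following one, when m steps to the opposite cone lie in between. *)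
Definition cycle_base (R : realType) (l : R) (m : nat) : R * R :=
  let mu := l ^+ m.+1 in
  let b := (mu * geom l m.+1 + l * geom l m) / (1 + mu ^+ 2) in
  (geom l m.+1 - mu * b, b).

(** The formal orbit that makes one step to the next cone every m + 1 steps:
    it is defined for every m, but need not stay in the quadrant. *)
Definition quadrant_cycle (R : realType) (l : R) (m n : nat) : R * R :=
  let r := (n %% m.+1)%N in
  (l ^+ r * (cycle_base l m).1 + geom l r,
   l ^+ r * (cycle_base l m).2 - geom l r).

Lemma quadrant_cycleS (R : realType) (l : R) m n : 0 < l < 1 ->
  quadrant_cycle l m n.+1 =
  quadrant_map l (m.+1 %| n.+1)%N (quadrant_cycle l m n).
Proof.
move=> /andP[l0 l1]; rewrite /quadrant_cycle modnS dvdSn_modn.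
have d0 : 1 + (l ^+ m.+1) ^+ 2 != 0.
  by have := exprn_ge0 2 (exprn_ge0 m.+1 (ltW l0)) => ?; apply/eqP; lra.
case: eqP => [->|_]; rewrite /quadrant_map /cycle_base /=.
  rewrite expr0 geom0 !geomS //; move: d0; rewrite (exprS l m) => d0.
  by congr pair; rewrite ?subr0 ?mul1r; field.
by rewrite (geomS (n %% m.+1)) // (exprS l (n %% m.+1)); congr pair; ring.
Qed.

(** The last ordinate of a cycle is where it may leave the quadrant, and its
    sign is opposite to that of the polynomial. *)
Lemma quadrant_cycle_last (R : realType) (l : R) m : 0 < l < 1 ->
  (quadrant_cycle l m m).2 = - gap l m / ((1 - l) * (1 + (l ^+ m.+1) ^+ 2)).
Proof.
move=> /andP[l0 l1].
have d0 : 1 + (l ^+ m.+1) ^+ 2 != 0.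
  by have := exprn_ge0 2 (exprn_ge0 m.+1 (ltW l0)) => ?; apply/eqP; lra.
rewrite /quadrant_cycle modn_small // /cycle_base /gap /geom /=.
rewrite mulnC exprM; move: d0; rewrite (exprS l m) => d0.
by field; rewrite d0 /=; apply/eqP; lra.
Qed.

Lemma quadrant_cycle_last_abs (R : realType) (l c : R) m : 0 < l < 1 ->
  c <= `|gap l m| ->
  (gap l m < 0 -> c / 2 <= (quadrant_cycle l m m).2) /\
  (~ gap l m < 0 -> (quadrant_cycle l m m).2 <= - (c / 2)).
Proof.
move=> /[dup] l01 /andP[l0 l1] hc; rewrite quadrant_cycle_last //.
have y0 : 0 <= (l ^+ m.+1) ^+ 2 by rewrite exprn_ge0 // exprn_ge0 // ltW.
have y1 : (l ^+ m.+1) ^+ 2 <= 1.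
  by rewrite exprn_ile1 ?exprn_ge0 ?exprn_ile1 // ltW.
set d := (1 - l) * _.
have d0 : 0 < d by rewrite /d; nra.
have d2 : d <= 2 by rewrite /d; nra.
split=> [g0|/negP]; last first.
  rewrite -leNgt => g0; move: hc; rewrite ger0_norm // => hc.
  by rewrite ler_pdivrMr //; nra.
move: hc; rewrite ltr0_norm // => hc.
by rewrite ler_pdivlMr //; nra.
Qed.

(** Along a block the ordinate decreases, so the last one is the smallest. The
    first abscissa is even larger than the last ordinate, as the latter is
    l^(2m+1) times the former minus something nonnegative; the other abscissas
    are at least 1. *)
Lemma quadrant_cycle_margin (R : realType) (l c : R) m n :
  0 < l < 1 -> 0 < c <= 1 -> c <= `|gap l m| -> gap l m < 0 ->
  c / 2 <= (quadrant_cycle l m n).1 /\ c / 2 <= (quadrant_cycle l m n).2.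
Proof.
move=> /[dup] l01 /andP[l0 l1] /andP[c0 c1] hc g0.
have [/(_ g0) hlast _] := quadrant_cycle_last_abs l01 hc.
have eqb : (cycle_base l m).2 = l * (l ^+ m * (cycle_base l m).1 + geom l m).
  have := @quadrant_cycleS R l m m l01.
  rewrite dvdnn /quadrant_map /quadrant_cycle modnn modn_small //.
  by rewrite geom0 expr0 !mul1r subr0 => -[_].
have rm : (n %% m.+1 <= m)%N by rewrite -ltnS ltn_pmod.
move: hlast eqb; rewrite /quadrant_cycle modn_small //.
case: (cycle_base l m) => a b /= hlast eqb.
have pow0 j : 0 < l ^+ j by apply: exprn_gt0.
have pow1 j : l ^+ j <= 1 by apply: exprn_ile1; exact: ltW.
have b0 : 0 < b.
  have := geom_ge0 m l01; have := pow0 m => h1 h2.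
  have h : 0 < l ^+ m * b by lra.
  by rewrite pmulr_rgt0 in h.
have ha : c / 2 <= a.
  have g := geom_ge0 m l01.
  move: hlast; rewrite eqb => hlast.
  have h1 : c / 2 <= l ^+ m * l * l ^+ m * a.
    have : l ^+ m * l * geom l m <= 1 * geom l m.
      by apply: ler_wpM2r => //; have := pow1 m.+1; rewrite exprSr.
    nra.
  have q0 : 0 < l ^+ m * l * l ^+ m by rewrite !mulr_gt0.
  have q1 : l ^+ m * l * l ^+ m <= 1.
    by rewrite -exprSr -exprD.
  have a0 : 0 < a by rewrite -(pmulr_rgt0 a q0); lra.
  nra.
split.
  case: (n %% m.+1)%N => [|r]; first by rewrite expr0 geom0; lra.
  by have := geomS_ge1 r l01; have := pow0 r.+1; nra.
set r := (n %% m.+1)%N in rm *.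
suff decr j : (r <= j)%N -> l ^+ j * b - geom l j <= l ^+ r * b - geom l r.
  exact: le_trans hlast (decr _ rm).
elim: j => [|j IH]; first by rewrite leqn0 => /eqP ->.
rewrite leq_eqVlt => /orP[/eqP -> //|]; rewrite ltnS => /IH.
apply: le_trans; rewrite geomS // exprS.
have pj := pow0 j.
have -> : l * geom l j = geom l j - 1 + l ^+ j by rewrite /geom; field; lra.
have : 0 <= (1 - l) * (l ^+ j * b) by rewrite mulr_ge0 ?mulr_ge0; lra.
lra.
Qed.

Definition sup_dist (R : realType) (p q : R * R) : R :=
  Num.max `|p.1 - q.1| `|p.2 - q.2|.

Lemma quadrant_map_contracts (R : realType) (l : R) s (p q : R * R) : 0 <= l ->
  sup_dist (quadrant_map l s p) (quadrant_map l s q) = l * sup_dist p q.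
Proof.
move=> l0; rewrite /sup_dist /quadrant_map maxr_pMr //; case: s => /=.
  have -> : 1 - l * p.2 - (1 - l * q.2) = - (l * (p.2 - q.2)) by ring.
  by rewrite -mulrBr normrN !normrM (ger0_norm l0) maxC.
have -> : 1 + l * p.1 - (1 + l * q.1) = l * (p.1 - q.1) by ring.
have -> : l * p.2 - 1 - (l * q.2 - 1) = l * (p.2 - q.2) by ring.
by rewrite !normrM (ger0_norm l0).
Qed.

Lemma quadrant_cycle_attracts (R : realType) (l e : R) m (p : nat -> R * R) :
  0 < l < 1 -> 0 < e ->
  (forall n, p n.+1 = quadrant_map l (m.+1 %| n.+1)%N (p n)) ->
  exists N, forall n, (N <= n)%N -> sup_dist (p n) (quadrant_cycle l m n) <= e.
Proof.
move=> /[dup] l01 /andP[l0 l1] e0 orbit.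
apply: (@recursion_eventually_le R l 0 e _ 0); first lra.
  by rewrite mulr_gt0 // subr_gt0.
move=> n _; rewrite orbit quadrant_cycleS // quadrant_map_contracts ?(ltW l0) //.
by rewrite addr0.
Qed.

(** An orbit that almost stays in the quadrant settles on a cycle whose last
    ordinate is, in the limit, almost nonnegative; as the polynomials are
    bounded away from 0, the cycle lies inside the quadrant. *)
Lemma quadrant_orbit_settles (R : realType) (l k c : R) (s : nat -> bool)
    (p : nat -> R * R) :
  0 < l < 1 -> 0 < k -> 2 * k < 1 - l ^+ 2 -> k < c / 2 ->
  (forall m, c <= `|gap l m|) ->
  (forall n, p n.+1 = quadrant_map l (s n) (p n)) ->
  (forall n, - k <= (p n).1 /\ - k <= (p n).2) ->
  exists m N, gap l m < 0 /\ forall n, s (N + n)%N = (m.+1 %| n.+1)%N.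
Proof.
move=> l01 k0 kl kc hc orbit quad.
have [m [N itin]] := quadrant_itinerary l01 k0 kl orbit quad.
exists m, N; split=> //; apply: contrapT => g0.
have [_ /(_ g0) hlast] := quadrant_cycle_last_abs l01 (hc m).
have e0 : 0 < (c / 2 - k) / 2 by lra.
have tail_orbit n : p (N + n.+1)%N = quadrant_map l (m.+1 %| n.+1)%N (p (N + n)%N).
  by rewrite addnS orbit itin.
have [N' close] :=
  quadrant_cycle_attracts (p := fun n => p (N + n)%N) l01 e0 tail_orbit.
have N'm : (N' <= m + N' * m.+1)%N by lia.
have := close _ N'm; rewrite /sup_dist ge_max => /andP[_].
have -> : quadrant_cycle l m (m + N' * m.+1) = quadrant_cycle l m m.
  by rewrite /quadrant_cycle addnC modnMDl.
have [_] := quad (N + (m + N' * m.+1))%N.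
by rewrite ler_norml => h1 /andP[h2 h3]; lra.
Qed.

(** * The polynomials are bounded away from zero *)

Lemma finite_lower_bound (R : realType) (u : nat -> R) n0 :
  (forall n, (n < n0)%N -> 0 < u n) ->
  exists2 c, 0 < c & forall n, (n < n0)%N -> c <= u n.
Proof.
elim: n0 => [_|j IH u0]; first by exists 1.
have [|c c0 Hc] := IH; first by move=> n nj; apply: u0; exact: leqW.
exists (Num.min c (u j)); first by rewrite lt_min c0 u0.
move=> n; rewrite ltnS leq_eqVlt => /orP[/eqP->|/Hc h].
  by rewrite ge_min lexx orbT.
by rewrite ge_min h.
Qed.

Lemma bounded_away (R : realType) (u : nat -> R) n0 :
  (forall n, u n != 0) -> (forall n, (n0 <= n)%N -> 1 / 2 <= u n) ->
  exists2 c, 0 < c <= 1 & forall n, c <= `|u n|.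
Proof.
move=> u0 H.
have [|c c0 Hc] := @finite_lower_bound R (fun n => `|u n|) n0.
  by move=> n _; rewrite normr_gt0.
exists (Num.min c (1 / 2)); first by rewrite lt_min ge_min; lra.
move=> n; case: (ltnP n n0) => [/Hc h|/H h]; rewrite ge_min ?h //.
by apply/orP; right; have := ler_norm (u n); lra.
Qed.

Lemma gap_eventually (R : realType) (l : R) : 0 < l < 1 ->
  exists n0, forall m, (n0 <= m)%N -> 1 / 2 <= gap l m.
Proof.
move=> /andP[l0 l1].
have q : (0 : R) < 1 / 4 by lra.
have [|N HN] := expr_eventually_lt (_ : 0 <= l < 1) q; first lra.
exists N => m Nm; rewrite /gap.
have h1 := HN _ Nm; have h2 := HN _ (leqW Nm).
have h3 : 0 <= l ^+ (2 * m.+1) by rewrite exprn_ge0 // ltW.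
lra.
Qed.

Lemma gap_bounded_away (R : realType) (l : R) : 0 < l < 1 -> ~ @Lambda R l ->
  exists2 c, 0 < c <= 1 & forall m, c <= `|gap l m|.
Proof.
move=> l01 notL; have [n0 Hn0] := gap_eventually l01.
apply: (@bounded_away R (gap l) n0) => // m; apply/eqP => g0; apply: notL.
exists m.+1 => //; split; first lra.
exact: g0.
Qed.

(** * The modulus of complex numbers *)

Lemma normc_ge0 (R : realType) (z : R[i]) : 0 <= Normc.normc z.
Proof. by case: z => a b; exact: sqrtr_ge0. Qed.

Lemma normc_triangle (R : realType) (x y z : R[i]) :
  Normc.normc (x - z) <= Normc.normc (x - y) + Normc.normc (y - z).
Proof.
have := le_normcD (x - y : Rcomplex R) (y - z : Rcomplex R).
by rewrite [X in X <= _ -> _](_ : _ = Normc.normc (x - z)) // addrA subrK.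
Qed.

Lemma normc_distC (R : realType) (x y : R[i]) :
  Normc.normc (x - y) = Normc.normc (y - x).
Proof. by rewrite -opprB; exact: (normcN (y - x : Rcomplex R)). Qed.

Lemma normc_eq0P (R : realType) (x y : R[i]) : Normc.normc (x - y) = 0 -> x = y.
Proof. by move/Normc.eq0_normc/eqP; rewrite subr_eq0 => /eqP. Qed.

Lemma normc_le_ReIm (R : realType) (z : R[i]) :
  Normc.normc z <= `|complex.Re z| + `|complex.Im z|.
Proof.
case: z => a b /=.
have a0 := normr_ge0 a; have b0 := normr_ge0 b.
rewrite -[leRHS]ger0_norm ?addr_ge0 // -sqrtr_sqr ler_sqrt ?sqr_ge0 //.
rewrite -(real_normK (num_real a)) -(real_normK (num_real b)).
have := mulr_ge0 a0 b0; rewrite !expr2; nra.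
Qed.

Lemma nbhs_normc (R : realType) (p : R[i]) (B : set R[i]) :
  nbhs (p : R[i]^o) B <->
  exists2 e : R, 0 < e & forall q, Normc.normc (p - q) < e -> B q.
Proof.
split=> [/nbhs_ballP[e /= e0 H]|[e e0 H]].
  move: e0 H; case: e => e f; rewrite ltcE /= => /andP[/eqP -> e0] H.
  exists e => // q pq; apply: H; rewrite -ball_normE /=.
  by rewrite ltcE /= eqxx.
apply/nbhs_ballP; exists e%:C; first by rewrite /= ltcE /= eqxx.
by move=> q; rewrite -ball_normE /= ltcE /= eqxx => /H.
Qed.

(** * Maps all of whose orbits converge to prescribed cycles *)

(** Each cycle is parametrised by time, over all natural numbers: then the
    billiard acts as the successor, and two points agree exactly when they have
    the same cycle and the same time modulo its period. *)
Record cycle_system (R : realType) (k : nat) (w : 'I_k -> R[i])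
    (lam : 'I_k -> R) (M : set nat) (per : nat -> nat)
    (C : nat -> nat -> R[i]) : Prop := CycleSystem {
  cycle_nonsingular : forall m n, M m -> nonsingular w lam (C m n);
  cycle_step : forall m n, M m -> billiard w lam (C m n) = C m n.+1;
  cycle_per_gt0 : forall m, (0 < per m)%N;
  cycle_periodic : forall m n, C m (n + per m)%N = C m n;
  cycle_inj : forall m n m' n', M m -> M m' -> C m n = C m' n' ->
    m = m' /\ n = n' %[mod per m];
  cycle_attracting : forall z, nonsingular w lam z ->
    exists m j, M m /\ forall e : R, 0 < e -> exists n0, forall n, (n0 <= n)%N ->
      Normc.normc (iter n (billiard w lam) z - C m (j + n)%N) < e
}.

Section CycleSystem.
Variables (R : realType) (k : nat) (w : 'I_k -> R[i]) (lam : 'I_k -> R).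
Variables (M : set nat) (per : nat -> nat) (C : nat -> nat -> R[i]).
Hypothesis sys : cycle_system w lam M per C.

Local Notation T := (billiard w lam).

Definition cycle_set m : set R[i] := [set C m n | n in [set: nat]].

Let per_gt0 m : (0 < per m)%N. Proof. exact: (cycle_per_gt0 sys). Qed.

Lemma cycle_addM m n q : C m (n + q * per m)%N = C m n.
Proof.
elim: q => [|q IH]; first by rewrite mul0n addn0.
by rewrite mulSn addnCA addnC (cycle_periodic sys).
Qed.

Lemma cycle_mod m n : C m (n %% per m)%N = C m n.
Proof. by rewrite {2}(divn_eq n (per m)) addnC cycle_addM. Qed.

(** Thanks to this an orbit that follows the cycle from phase [j] comes back
    arbitrarily late to any given point of it. *)
Lemma cycle_phase m j r n0 : exists2 n, (n0 <= n)%N & C m (j + n)%N = C m r.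
Proof.
have le := leq_pmulr (j + n0) (per_gt0 m).
exists (r + (j + n0) * per m - j)%N; first by lia.
by rewrite -(cycle_addM m r (j + n0)); congr (C m _); lia.
Qed.

Lemma iter_cycle m j n : M m -> iter n T (C m j) = C m (j + n)%N.
Proof.
move=> Mm; elim: n => [|n IH]; first by rewrite addn0.
by rewrite iterS IH (cycle_step sys) // addnS.
Qed.

Lemma forward_orbit_cycle m j : M m -> forward_orbit w lam (C m j) = cycle_set m.
Proof.
move=> Mm; apply/seteqP; split=> z [n _ <-].
  by exists (j + n)%N => //; rewrite iter_cycle.
have [n' _ e] := cycle_phase m j n 0.
by exists n' => //; rewrite iter_cycle.
Qed.

Lemma minimal_period_cycle m j : M m -> minimal_period w lam (C m j) (per m).
Proof.
move=> Mm; split=> //; first by rewrite iter_cycle // (cycle_periodic sys).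
move=> q /andP[q0 qp]; rewrite iter_cycle // => /(cycle_inj sys Mm Mm)[_].
rewrite -[X in _ = X %[mod _]]addn0 => /eqP.
by rewrite eqn_modDl modn_small // mod0n; lia.
Qed.

Lemma minimal_period_unique z p q :
  minimal_period w lam z p -> minimal_period w lam z q -> p = q.
Proof.
move=> [p0 ep mp] [q0 eq mq].
by case: (ltngtP p q) => // h; [have := mq p|have := mp q];
  rewrite h ?p0 ?q0 => /(_ erefl).
Qed.

Lemma cycle_set_inj m m' : M m -> M m' -> cycle_set m = cycle_set m' -> m = m'.
Proof.
move=> Mm Mm' e.
have : cycle_set m' (C m 0) by rewrite -e; exists 0%N.
by case=> n _ /esym /(cycle_inj sys Mm Mm')[].
Qed.

(** A cycle is finite, so a point outside it has a positive distance to it. *)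
Lemma omega_limit_cycle z m j :
  (forall e : R, 0 < e -> exists n0, forall n, (n0 <= n)%N ->
      Normc.normc (iter n T z - C m (j + n)%N) < e) ->
  omega_limit w lam z = cycle_set m.
Proof.
move=> attr; apply/seteqP; split=> p; last first.
  case=> r _ <- A B [N _ HA] /nbhs_normc[e e0 HB].
  have [n0 Hn0] := attr e e0.
  have [n n_ge en] := cycle_phase m j r (maxn N n0).
  exists (iter n T z); split; first by apply: HA => /=; lia.
  by apply: HB; rewrite normc_distC -en; apply: Hn0; lia.
move=> cl; apply: contrapT => notin.
have [|e e0 He] := @finite_lower_bound R (fun n => Normc.normc (p - C m n)) (per m).
  move=> n _; rewrite lt_neqAle normc_ge0 andbT eq_sym; apply/eqP => /normc_eq0P e.
  by apply: notin; exists n.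
have e20 : 0 < e / 2 by lra.
have [n0 Hn0] := attr _ e20.
have [] := cl [set q | exists n, Normc.normc (q - C m n) < e / 2]
              [set q | Normc.normc (p - q) < e / 2].
- by exists n0 => // n /= /Hn0 h; exists (j + n)%N.
- by apply/nbhs_normc; exists (e / 2).
move=> q /= [[n hn] hq].
have := He (n %% per m)%N; rewrite ltn_mod => /(_ (per_gt0 m)).
by rewrite cycle_mod; have := normc_triangle p q (C m n); lra.
Qed.

Lemma omega_cycles : omega w lam = \bigcup_(m in M) cycle_set m.
Proof.
apply/seteqP; split=> z.
  move=> [y ns]; have [m [j [Mm attr]]] := cycle_attracting sys ns.
  by rewrite (omega_limit_cycle attr) => ?; exists m.
move=> [m Mm zm]; exists (C m 0); first exact: (cycle_nonsingular sys).
rewrite (@omega_limit_cycle (C m 0) m 0) // => e e0.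
by exists 0%N => n _; rewrite iter_cycle // subrr Normc.normc0.
Qed.

(** A periodic orbit keeps its distance to the cycle that attracts it, so
    that this distance is zero. *)
Lemma periodic_in_cycle z p : nonsingular w lam z -> (0 < p)%N ->
  iter p T z = z -> exists m j, M m /\ z = C m j.
Proof.
move=> ns p0 pz; have [m [j [Mm attr]]] := cycle_attracting sys ns.
exists m, j; split=> //; apply: normc_eq0P; apply/eqP.
rewrite eq_le normc_ge0 andbT leNgt; apply/negP => d0.
have [n0 Hn0] := attr _ d0.
have /Hn0 : (n0 <= n0 * (p * per m))%N by rewrite leq_pmulr // muln_gt0 p0 per_gt0.
have -> : iter (n0 * (p * per m)) T z = z.
  rewrite mulnCA; elim: (n0 * per m)%N => [|q IH]; first by rewrite muln0.
  by rewrite mulnS iterD IH.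
by rewrite mulnA cycle_addM ltxx.
Qed.

Lemma orbit_of_periodP p O : orbit_of_period w lam p O <->
  exists2 m, M m & p = per m /\ O = cycle_set m.
Proof.
split=> [[z [ns mp ->]]|[m Mm [-> ->]]]; last first.
  exists (C m 0); split; first exact: (cycle_nonsingular sys).
    exact: minimal_period_cycle.
  by rewrite forward_orbit_cycle.
have [p0 pz _] := mp.
have [m [j [Mm ez]]] := periodic_in_cycle ns p0 pz.
exists m => //; split; last by rewrite ez forward_orbit_cycle.
by apply: (minimal_period_unique mp); rewrite ez; exact: minimal_period_cycle.
Qed.

Lemma periodic_orbitsE : periodic_orbits w lam = [set cycle_set m | m in M].
Proof.
apply/seteqP; split=> O.
  by move=> [p _ /orbit_of_periodP[m Mm [_ ->]]]; exists m.
by move=> [m Mm <-]; exists (per m) => //; apply/orbit_of_periodP; exists m.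
Qed.

Lemma cycles_asymptotically_periodic :
  finite_set M -> asymptotically_periodic w lam.
Proof.
move=> finM; exists [set cycle_set m | m in M]; split.
- exact: finite_image.
- by rewrite periodic_orbitsE.
- by rewrite omega_cycles bigcup_image.
move=> z ns; have [m [j [Mm attr]]] := cycle_attracting sys ns.
exists (cycle_set m); first by exists m.
apply: (@squeeze_cvge _ _ _ _ (fun=> 0%E) _
  (fun n => (Normc.normc (iter n T z - C m (j + n)%N))%:E)).
- near=> n; apply/andP; split.
    by apply: le_ereal_inf_tmp => _ [a _ <-]; rewrite lee_fin normc_ge0.
  by apply: ereal_inf_lbound; exists (C m (j + n)%N) => //; exists (j + n)%N.
- exact: cvg_cst.
- apply: cvg_EFin; first by near=> n.
  apply/cvgrPdist_lt => e e0; have [n0 Hn0] := attr _ e0.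
  exists n0 => // n /= /Hn0 h.
  by rewrite sub0r normrN ger0_norm ?normc_ge0.
Unshelve. all: by end_near.
Qed.

Definition phases : set (nat * nat) := [set mn | M mn.1 /\ (mn.2 < per mn.1)%N].

Lemma omega_card : (omega w lam #= phases)%card.
Proof.
have -> : omega w lam = [set C mn.1 mn.2 | mn in phases].
  rewrite omega_cycles; apply/seteqP; split=> z.
    move=> [m Mm [n _ <-]]; exists (m, n %% per m)%N => /=.
      by split=> //=; rewrite ltn_mod.
    by rewrite cycle_mod.
  by move=> [[m n] /= [/= Mm _] <-]; exists m => //; exists n.
apply: inj_card_eq => -[m n] [m' n']; rewrite !inE /phases /=.
move=> [Mm nm] [Mm' nm'] /(cycle_inj sys Mm Mm')[e]; subst m'.
by rewrite !modn_small // => ->.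
Qed.

End CycleSystem.

(** * Comparison of two cycle systems *)

Section Comparison.
Variables (R : realType) (k : nat) (w w' : 'I_k -> R[i]) (lam lam' : 'I_k -> R).
Variables (M : set nat) (per : nat -> nat) (C C' : nat -> nat -> R[i]).
Hypothesis sys : cycle_system w lam M per C.
Hypothesis sys' : cycle_system w' lam' M per C'.

Lemma cycle_systems_omega_card : (omega w' lam' #= omega w lam)%card.
Proof.
by apply: card_eq_trans (omega_card sys') _; rewrite card_eq_sym (omega_card sys).
Qed.

Lemma cycle_systems_hausdorff (e : R) :
  (forall m n, M m -> Normc.normc (C' m n - C m n) <= e) ->
  (hausdorff_dist (omega w' lam') (omega w lam) <= e%:E)%E.
Proof.
move=> close; rewrite /hausdorff_dist (omega_cycles sys) (omega_cycles sys').
rewrite ge_max; apply/andP; split; apply: ge_ereal_sup => _ [_ [m Mm [n _ <-]] <-].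
- apply: (@le_trans _ _ (Normc.normc (C' m n - C m n))%:E).
    by apply: ereal_inf_lbound; exists (C m n) => //; exists m => //; exists n.
  by rewrite lee_fin close.
- apply: (@le_trans _ _ (Normc.normc (C m n - C' m n))%:E).
    by apply: ereal_inf_lbound; exists (C' m n) => //; exists m => //; exists n.
  by rewrite lee_fin normc_distC close.
Qed.

Lemma cycle_systems_bij : exists phi : set R[i] -> set R[i],
  set_bij (periodic_orbits w' lam') (periodic_orbits w lam) phi /\
  forall (p : nat) (O : set R[i]), periodic_orbits w' lam' O ->
    (orbit_of_period w' lam' p O <-> orbit_of_period w lam p (phi O)).
Proof.
(* The union has a single term, as a cycle determines its index m. *)
pose phi O := \bigcup_(m in [set m | M m /\ O = cycle_set C' m]) cycle_set C m.
have phiE m : M m -> phi (cycle_set C' m) = cycle_set C m.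
  move=> Mm; apply/seteqP; split=> z; last by exists m.
  by move=> [m' [Mm' /(cycle_set_inj sys' Mm Mm') <-]].
exists phi; rewrite (periodic_orbitsE sys) (periodic_orbitsE sys'); split.
  split=> [_ [m Mm <-]|O O'|_ [m Mm <-]].
  - by rewrite phiE //; exists m.
  - rewrite !inE => -[m Mm <-] [m' Mm' <-]; rewrite !phiE //.
    by move=> /(cycle_set_inj sys Mm Mm') ->.
  - by exists (cycle_set C' m); [exists m|rewrite phiE].
move=> p _ [m Mm <-]; rewrite phiE //.
rewrite (orbit_of_periodP sys) (orbit_of_periodP sys').
split=> -[m' Mm' [-> e]]; exists m' => //; split=> //.
  by rewrite (cycle_set_inj sys' Mm Mm' e).
by rewrite (cycle_set_inj sys Mm Mm' e).
Qed.

End Comparison.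

(** * The itineraries of the cycles *)

Definition turn (s : bool) : nat := if s then 1 else 2.

(** Each step moves the index of the cone by 2, except that one step in every
    m + 1 moves it by 1; the factor 3 stands for -1 modulo 4. *)
Definition cycle_index (m n : nat) : 'I_4 :=
  inord ((2 * n + 3 * (n %/ m.+1)) %% 4)%N.

Lemma cycle_indexE m n : cycle_index m n = ((2 * n + 3 * (n %/ m.+1)) %% 4)%N :> nat.
Proof. by rewrite inordK // ltn_mod. Qed.

Lemma cycle_indexS m n :
  cycle_index m n.+1 = (cycle_index m n + turn (m.+1 %| n.+1))%N %[mod 4].
Proof.
rewrite !cycle_indexE modn_mod modnDml divnS // /turn.
by case: (m.+1 %| n.+1)%N; rewrite ?add0n ?add1n; lia.
Qed.

Lemma cycle_index_periodic m n : cycle_index m (n + 4 * m.+1)%N = cycle_index m n.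
Proof.
by apply: val_inj; rewrite /= !cycle_indexE divnDMl //; lia.
Qed.

Lemma cycle_index_addM m n q :
  cycle_index m (n + q * (4 * m.+1))%N = cycle_index m n.
Proof.
elim: q => [|q IH]; first by rewrite mul0n addn0.
by rewrite mulSn addnCA addnC cycle_index_periodic.
Qed.

(** A block turns the index by 2m + 1, which generates the residues modulo 4,
    so each starting index is met at the start of some block. *)
Lemma cycle_index_shift m r : exists j, forall n,
  cycle_index m (j + n)%N = (r + cycle_index m n)%N %[mod 4].
Proof.
(* 2m + 5 is congruent to 2m + 1, and the square of an odd number to 1. *)
exists (r * (2 * m + 5) * m.+1)%N => n.
rewrite !cycle_indexE modn_mod modnDmr divnMDl //.
have -> : (2 * (r * (2 * m + 5) * m.+1 + n) +
           3 * (r * (2 * m + 5) + n %/ m.+1) =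
           r * (m * m + 5 * m + 6) * 4 + (r + (2 * n + 3 * (n %/ m.+1))))%N by nia.
by rewrite modnMDl.
Qed.

(** The times at which the index moves by 1 reveal m, and the phase modulo
    m + 1; the index itself then reveals the number of blocks modulo 4. *)
Lemma cycle_index_inj m m' j j' :
  (forall n, cycle_index m (j + n)%N = cycle_index m' (j' + n)%N) ->
  m = m' /\ j = j' %[mod (4 * m.+1)%N].
Proof.
move=> H.
have hit n : (m.+1 %| (j + n).+1)%N = (m'.+1 %| (j' + n).+1)%N.
  have h1 := cycle_indexS m (j + n); have h2 := cycle_indexS m' (j' + n).
  have e0 := congr1 val (H n); have e1 := congr1 val (H n.+1).
  move: e0 e1 h1 h2; rewrite /= !addnS => -> -> -> /eqP.
  rewrite eqn_modDl /turn.
  by case: (m.+1 %| _)%N; case: (m'.+1 %| _)%N.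
have [n0 d0] : exists n0, (m.+1 %| (j + n0).+1)%N.
  exists (j * m.+1 + m - j)%N.
  have -> : ((j + (j * m.+1 + m - j)).+1 = j.+1 * m.+1)%N by nia.
  by rewrite dvdn_mull.
have d0' : (m'.+1 %| (j' + n0).+1)%N by rewrite -hit.
have mm' : m = m'.
  apply/eqP; rewrite -eqSS eqn_dvd; apply/andP; split.
    have := hit (n0 + m'.+1)%N; rewrite !addnA -(addSn (j + n0)) -(addSn (j' + n0)).
    by rewrite !dvdn_addr // dvdnn.
  have := hit (n0 + m.+1)%N; rewrite !addnA -(addSn (j + n0)) -(addSn (j' + n0)).
  by rewrite !dvdn_addr // dvdnn => <-.
split=> //; subst m'.
wlog le : j j' H hit n0 d0 d0' / (j <= j')%N.
  by case: (leqP j j') => [|/ltnW] h W; [|symmetry]; apply: (W _ _ _ _ n0).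
have : (m.+1 %| j' - j)%N.
  have -> : (j' - j = (j' + n0).+1 - (j + n0).+1)%N by lia.
  exact: dvdn_sub.
case/dvdnP=> q eq_q.
have ej' : j' = (q * m.+1 + j)%N by lia.
have := congr1 val (H 0%N); rewrite /= !cycle_indexE !addn0 ej' divnMDl // => e.
have q4 : (4 %| q)%N.
  have : (2 * (q * m.+1 + j) + 3 * (q + j %/ m.+1) =
          q * (2 * m + 5) + (2 * j + 3 * (j %/ m.+1)))%N by nia.
  move=> ee; move: e; rewrite {}ee; move: (2 * j + _)%N => t.
  move/esym/eqP; rewrite -[X in _ == (X %% 4)%N]add0n eqn_modDr mod0n.
  rewrite -/(dvdn 4 _) Gauss_dvdl //.
  by rewrite (coprimeXl 2 (_ : coprime 2 _)) // coprime2n oddD oddM.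
case/dvdnP: q4 => q' ->.
by rewrite -mulnA modnMDl.
Qed.

(** * Charts of the square *)

(** The rotation of the plane that sends the cone of index i of the square to
    the first quadrant, for i < 4. *)
Definition chart (R : realType) (i : nat) (z : R[i]) : R * R :=
  let x := complex.Re z in let y := complex.Im z in
  match i with
  | 0 => (x, y)
  | 1 => (y + 1, - x)
  | 2 => (1 - x, - 1 - y)
  | _ => (- y, x - 1)
  end.

(** The branch of the billiard attached to one vertex, defined everywhere. *)
Definition vertex_map (R : realType) (k : nat) (w : 'I_k -> R[i])
    (lam : 'I_k -> R) (i : 'I_k) (z : R[i]) : R[i] :=
  - (lam i)%:C * z + (1 + lam i)%:C * w i.

Lemma Re_real_mul (R : realType) (a : R) (z : R[i]) :
  complex.Re (a%:C * z) = a * complex.Re z.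
Proof. by case: z => x y /=; rewrite mul0r subr0. Qed.

Lemma Im_real_mul (R : realType) (a : R) (z : R[i]) :
  complex.Im (a%:C * z) = a * complex.Im z.
Proof. by case: z => x y /=; rewrite mul0r addr0. Qed.

Lemma Re_add (R : realType) (z t : R[i]) :
  complex.Re (z + t) = complex.Re z + complex.Re t.
Proof. by case: z; case: t. Qed.

Lemma Im_add (R : realType) (z t : R[i]) :
  complex.Im (z + t) = complex.Im z + complex.Im t.
Proof. by case: z; case: t. Qed.

Lemma Re_opp (R : realType) (z : R[i]) : complex.Re (- z) = - complex.Re z.
Proof. by case: z. Qed.

Lemma Im_opp (R : realType) (z : R[i]) : complex.Im (- z) = - complex.Im z.
Proof. by case: z. Qed.

Definition ReE := (Re_add, Re_opp, Re_real_mul).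
Definition ImE := (Im_add, Im_opp, Im_real_mul).

Lemma eq_ReIm (R : realType) (z t : R[i]) :
  complex.Re z = complex.Re t -> complex.Im z = complex.Im t -> z = t.
Proof. by case: z => a b; case: t => a' b' /= -> ->. Qed.

Lemma Re_vertex_map (R : realType) k (w : 'I_k -> R[i]) lam i z :
  complex.Re (vertex_map w lam i z) =
  - lam i * complex.Re z + (1 + lam i) * complex.Re (w i).
Proof. by rewrite /vertex_map mulNr !ReE mulNr. Qed.

Lemma Im_vertex_map (R : realType) k (w : 'I_k -> R[i]) lam i z :
  complex.Im (vertex_map w lam i z) =
  - lam i * complex.Im z + (1 + lam i) * complex.Im (w i).
Proof. by rewrite /vertex_map mulNr !ImE mulNr. Qed.

Definition square_coords (R : realType) (i : nat) : R * R :=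
  match i with 0 => (0, 0) | 1 => (0, - 1) | 2 => (1, - 1) | _ => (1, 0) end.

Lemma Re_square (R : realType) (i : 'I_4) :
  complex.Re (unit_square R i) = (square_coords R i).1.
Proof.
case: i => [[|[|[|[|]]]] // h]; rewrite /unit_square (tnth_nth 0) /= ?oppr0 ?addr0 //.
all: lra.
Qed.

Lemma Im_square (R : realType) (i : 'I_4) :
  complex.Im (unit_square R i) = (square_coords R i).2.
Proof.
case: i => [[|[|[|[|]]]] // h]; rewrite /unit_square (tnth_nth 0) /= ?oppr0 ?addr0 //.
all: lra.
Qed.

(** By the four-fold symmetry of the square, all its cones see the same
    two affine maps. *)
Lemma chart_vertex_map (R : realType) (l : R) (i i' : 'I_4) (s : bool) (z : R[i]) :
  i' = (i + turn s)%N %[mod 4] ->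
  chart i' (vertex_map (@unit_square R) (fun=> l) i z) =
  quadrant_map l s (chart i z).
Proof.
rewrite /chart Re_vertex_map Im_vertex_map Re_square Im_square.
case: i => [[|[|[|[|]]]] // h]; case: i' => [[|[|[|[|]]]] // h'];
  case: s => // _; rewrite /quadrant_map /=; congr pair; ring.
Qed.

(** The image of a cone lies in the opposite quadrant at the same vertex, and
    this quadrant stays away from the cone of the previous vertex. It touches
    the cone it comes from at the vertex, whence the hypothesis that the cone
    changes. *)
Lemma next_cone (R : realType) (l k : R) (i i' : 'I_4) (z : R[i]) :
  0 < l < 1 -> 2 * k < 1 -> i' != i ->
  - k <= (chart i z).1 /\ - k <= (chart i z).2 ->
  (let z' := vertex_map (@unit_square R) (fun=> l) i z in
   - k <= (chart i' z').1 /\ - k <= (chart i' z').2) ->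
  i' = (i + turn (i' == (i.+1 %% 4)%N :> nat))%N %[mod 4].
Proof.
move=> /andP[l0 l1] k1.
rewrite /= /chart Re_vertex_map Im_vertex_map Re_square Im_square.
case: i => [[|[|[|[|]]]] // h]; case: i' => [[|[|[|[|]]]] // h'] //= _ [h1 h2] [h3 h4];
  exfalso; nra.
Qed.

Lemma chart_separated (R : realType) (g k : R) (i j : 'I_4) (z : R[i]) :
  0 < g -> k < g -> k < 1 -> g <= (chart i z).1 /\ g <= (chart i z).2 ->
  - k <= (chart j z).1 /\ - k <= (chart j z).2 -> i = j.
Proof.
move=> g0 kg k1; rewrite /chart.
case: i => [[|[|[|[|]]]] // h]; case: j => [[|[|[|[|]]]] // h'] /= [h1 h2] [h3 h4];
  by [apply: val_inj|exfalso; lra].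
Qed.

(** * Polygons close to the square *)

Definition near_square (R : realType) (l d : R) (w : 'I_4 -> R[i])
    (lam : 'I_4 -> R) : Prop :=
  forall i, [/\ `|complex.Re (w i) - complex.Re (unit_square R i)| <= d,
                `|complex.Im (w i) - complex.Im (unit_square R i)| <= d &
                `|lam i - l| <= d].

(** In the chart of the square, the basis of the cone of a nearby polygon is
    close to the canonical basis, and its vertex is close to 0. *)
Lemma cone_coords (R : realType) (l d : R) (w : 'I_4 -> R[i]) lam (i : 'I_4) :
  near_square l d w lam ->
  exists a1 a2 b1 b2 c1 c2 : R,
    [/\ `|a1 - 1| <= 2 * d /\ `|a2| <= 2 * d,
        `|b1| <= 2 * d /\ `|b2 - 1| <= 2 * d,
        `|c1| <= d /\ `|c2| <= d &
        forall (x y : R) (z : R[i]),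
          z = w i + x%:C * (w (ord_pred i) - w i) + y%:C * (w i - w (ordS i)) <->
          chart i z = (c1 + x * a1 + y * b1, c2 + x * a2 + y * b2)].
Proof.
move=> near.
have := near i; have := near (ordS i); have := near (ord_pred i).
rewrite !Re_square !Im_square => -[p1 p2 _] [s1 s2 _] [q1 q2 _].
pose lin (u : R[i]) := ((chart i u).1 - (chart i 0).1, (chart i u).2 - (chart i 0).2).
exists (lin (w (ord_pred i) - w i)).1, (lin (w (ord_pred i) - w i)).2,
  (lin (w i - w (ordS i))).1, (lin (w i - w (ordS i))).2,
  (chart i (w i)).1, (chart i (w i)).2.
move: p1 p2 s1 s2 q1 q2; rewrite !ler_norml => p1 p2 s1 s2 q1 q2.
rewrite /lin /chart {lin}.
have zE (x y : R) (z : R[i]) :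
  z = w i + x%:C * (w (ord_pred i) - w i) + y%:C * (w i - w (ordS i)) <->
  complex.Re z = complex.Re (w i) +
    x * (complex.Re (w (ord_pred i)) - complex.Re (w i)) +
    y * (complex.Re (w i) - complex.Re (w (ordS i))) /\
  complex.Im z = complex.Im (w i) +
    x * (complex.Im (w (ord_pred i)) - complex.Im (w i)) +
    y * (complex.Im (w i) - complex.Im (w (ordS i))).
  split=> [->|[h1 h2]]; first by rewrite !ReE !ImE.
  by apply: eq_ReIm; [rewrite !ReE|rewrite !ImE].
move: p1 p2 s1 s2 q1 q2 zE.
case: i => [[|[|[|[|]]]] // h]; rewrite /= /modn /= !ReE !ImE /= => p1 p2 s1 s2 q1 q2 zE;
  (split; [split; lra|split; lra|split; lra|];
   move=> x y z; rewrite zE; split=> [[-> ->]|[h1 h2]]; [congr pair; ring|lra]).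
Qed.

(** The bound on z matters: the boundary rays of the two cones make a small
    angle, and so they drift apart at infinity. *)
Lemma cone_chart (R : realType) (l d B : R) (w : 'I_4 -> R[i]) lam (i : 'I_4)
    (z : R[i]) :
  near_square l d w lam -> 0 <= d <= 1 / 16 -> 1 <= B ->
  `|complex.Re z| <= B -> `|complex.Im z| <= B -> cone w i z ->
  - (d * (8 * B + 9)) <= (chart i z).1 /\ - (d * (8 * B + 9)) <= (chart i z).2.
Proof.
move=> near /andP[d0 d1] B1 hx hy [x [y [x0 y0 ez]]].
have [a1 [a2 [b1 [b2 [c1 [c2 [[ha1 ha2] [hb1 hb2] [hc1 hc2] E]]]]]]] :=
  cone_coords i near.
have Ez := (E x y z).1 ez.
have [B1' B2'] : (chart i z).1 <= B + 1 /\ (chart i z).2 <= B + 1.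
  move: hx hy; rewrite !ler_norml => /andP[? ?] /andP[? ?]; rewrite /chart.
  by case: i {ez E Ez near} => [[|[|[|[|]]]] // h] /=; lra.
move: B1' B2'; rewrite Ez /=.
move: ha1 ha2 hb1 hb2 hc1 hc2; rewrite !ler_norml.
move=> /andP[? ?] /andP[? ?] /andP[? ?] /andP[? ?] /andP[? ?] /andP[? ?] h1 h2.
have xa1 : x * (1 - 2 * d) <= x * a1 by apply: ler_wpM2l; lra.
have xa2 : x * - (2 * d) <= x * a2 by apply: ler_wpM2l; lra.
have yb1 : y * - (2 * d) <= y * b1 by apply: ler_wpM2l; lra.
have yb2 : y * (1 - 2 * d) <= y * b2 by apply: ler_wpM2l; lra.
have xd : x * d <= x * (1 / 16) by apply: ler_wpM2l; lra.
have yd : y * d <= y * (1 / 16) by apply: ler_wpM2l; lra.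
have xB : x <= 4 * B + 4 by lra.
have yB : y <= 4 * B + 4 by lra.
have xdB : x * d <= (4 * B + 4) * d by apply: ler_wpM2r.
have ydB : y * d <= (4 * B + 4) * d by apply: ler_wpM2r.
have x0d : 0 <= x * d by apply: mulr_ge0; lra.
have y0d : 0 <= y * d by apply: mulr_ge0; lra.
split; lra.
Qed.

(** Cramer's rule in the basis of the cone. *)
Lemma chart_cone (R : realType) (l d B g : R) (w : 'I_4 -> R[i]) lam (i : 'I_4)
    (z : R[i]) :
  near_square l d w lam -> 0 <= d <= 1 / 16 -> 1 <= B -> d * (8 * B + 9) < g ->
  `|complex.Re z| <= B -> `|complex.Im z| <= B ->
  g <= (chart i z).1 /\ g <= (chart i z).2 -> cone w i z.
Proof.
move=> near /andP[d0 d1] B1 dg hx hy [g1 g2].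
have [a1 [a2 [b1 [b2 [c1 [c2 [[ha1 ha2] [hb1 hb2] [hc1 hc2] E]]]]]]] :=
  cone_coords i near.
have [B1' B2'] : (chart i z).1 <= B + 1 /\ (chart i z).2 <= B + 1.
  move: hx hy; rewrite !ler_norml => /andP[? ?] /andP[? ?]; rewrite /chart.
  by case: i {E near g1 g2} => [[|[|[|[|]]]] // h] /=; lra.
move: {hx hy} (E) B1' B2' g1 g2; case ez: (chart i z) => [X Y] /=.
move=> {}E B1' B2' g1 g2.
move: ha1 ha2 hb1 hb2 hc1 hc2; rewrite !ler_norml.
move=> /andP[? ?] /andP[? ?] /andP[? ?] /andP[? ?] /andP[? ?] /andP[? ?].
pose u := X - c1; pose v := Y - c2; pose D := a1 * b2 - a2 * b1.
have D0 : 0 < D.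
  have : (1 - 2 * d) * (1 - 2 * d) <= a1 * b2 by apply: ler_pM; lra.
  have : `|a2 * b1| <= (2 * d) * (2 * d).
    by rewrite normrM; apply: ler_pM => //; rewrite ler_norml; lra.
  by rewrite ler_norml /D => /andP[_ h1] h2; nra.
have dB : 0 <= d * B by apply: mulr_ge0; lra.
have cramer (s t p q : R) : d * (8 * B + 8) < s -> 0 <= t <= B + 2 ->
    - (2 * d) <= p - 1 -> q <= 2 * d -> 0 < (s * p - t * q) / D.
  move=> hs /andP[t0 tB] hp hq; apply: divr_gt0 => //.
  have : s * (7 / 8) <= s * p by apply: ler_wpM2l; lra.
  have : t * q <= t * (2 * d) by apply: ler_wpM2l.
  have : t * (2 * d) <= (B + 2) * (2 * d) by apply: ler_wpM2r => //; lra.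
  lra.
have x0 : 0 < (u * b2 - v * b1) / D by apply: cramer; rewrite /u /v; lra.
have y0 : 0 < (v * a1 - u * a2) / D by apply: cramer; rewrite /u /v; lra.
exists ((u * b2 - v * b1) / D), ((v * a1 - u * a2) / D); split=> //.
apply/E; rewrite ez; congr pair; rewrite /u /v /D; field;
  by move: D0; rewrite /D lt0r => /andP[].
Qed.

(** * Convexity *)

Lemma det2E (R : realType) (a b : R[i]) :
  det2 a b = complex.Re a * complex.Im b - complex.Im a * complex.Re b.
Proof. by []. Qed.

Lemma det2_sumr (R : realType) (I : finType) (a b : R[i]) (t : I -> R)
    (f : I -> R[i]) :
  \sum_i t i = 1 ->
  det2 a (\sum_i (t i)%:C * f i - b) = \sum_i t i * det2 a (f i - b).
Proof.
move=> t1.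
have -> : \sum_i (t i)%:C * f i - b = \sum_i (t i)%:C * (f i - b).
  under [RHS]eq_bigr do rewrite mulrBr.
  by rewrite sumrB -mulr_suml -(raddf_sum (real_complex R)) t1 mul1r.
elim/big_rec2: _ => [|i y1 y2 _ <-]; first by rewrite det2E /= !mulr0 subrr.
by rewrite !det2E !ReE !ImE; ring.
Qed.

Section Convex.
Variables (R : realType) (k : nat) (w : 'I_k -> R[i]).
Hypothesis convex : convex_ccw w.

Lemma polygon_edge_left (z : R[i]) (i : 'I_k) :
  polygon w z -> 0 <= det2 (w (ordS i) - w i) (z - w i).
Proof.
move=> [t [t0 t1 ->]]; rewrite det2_sumr //; apply: sumr_ge0 => j _.
apply: mulr_ge0 => //; have [_ conv] := convex.
have [->|ji] := eqVneq j i; first by rewrite det2E subrr /= !mulr0 subrr.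
have [->|jS] := eqVneq j (ordS i); first by rewrite det2E mulrC subrr.
exact: ltW (conv _ _ ji jS).
Qed.

Lemma neighbours_distinct (i : 'I_k) :
  [/\ ord_pred i != i, ordS i != i & ord_pred i != ordS i].
Proof.
have [k3 _] := convex; have ik := ltn_ord i.
have Si : ordS i != i.
  apply/eqP => /(congr1 val) /=; case: (ltnP i.+1 k) => h.
    by rewrite modn_small //; lia.
  by rewrite (_ : i.+1 = k) ?modnn //; lia.
split=> //; apply/eqP => /(congr1 (@ordS k)); rewrite ord_predK => e.
  by move: Si; rewrite -e eqxx.
move/(congr1 val): e => /=; case: (ltnP i.+1 k) => h.
  rewrite (modn_small h); case: (ltnP i.+2 k) => h'.
    by rewrite modn_small //; lia.
  by rewrite (_ : i.+2 = k) ?modnn //; lia.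
by rewrite (_ : i.+1 = k) ?modnn ?modn_small //; lia.
Qed.

Lemma cone_edge_left (z : R[i]) (i : 'I_k) :
  cone w i z -> 0 < det2 (w (ordS i) - w i) (z - w i).
Proof.
move=> [x [y [x0 y0 ->]]]; have [_ conv] := convex.
have [n1 n2 n3] := neighbours_distinct i.
have -> : det2 (w (ordS i) - w i) (w i + x%:C * (w (ord_pred i) - w i) +
    y%:C * (w i - w (ordS i)) - w i) =
    x * det2 (w (ordS i) - w i) (w (ord_pred i) - w i).
  by rewrite !det2E !ReE !ImE; ring.
by apply: mulr_gt0 => //; exact: conv.
Qed.

(** A cone lies to the right of the edge that arrives at its vertex. *)
Lemma cone_exterior (z : R[i]) (i : 'I_k) : cone w i z -> exterior w z.
Proof.
move=> [x [y [x0 y0 ez]]] /(polygon_edge_left (ord_pred i)).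
have [n1 n2 n3] := neighbours_distinct i; have [_ conv] := convex.
have := conv (ord_pred i) (ordS i).
rewrite ez ord_predK => /(_ _ n2); rewrite eq_sym n3 => /(_ isT) h.
have -> : det2 (w i - w (ord_pred i)) (w i + x%:C * (w (ord_pred i) - w i) +
    y%:C * (w i - w (ordS i)) - w (ord_pred i)) =
    - (y * det2 (w i - w (ord_pred i)) (w (ordS i) - w (ord_pred i))).
  by rewrite !det2E !ReE !ImE; ring.
by rewrite oppr_ge0 leNgt mulr_gt0.
Qed.

(** The image of a cone is in the opposite cone at the same vertex, which lies
    to the right of the edge that leaves that vertex. *)
Lemma vertex_map_edge_right (lam : 'I_k -> R) (z : R[i]) (i : 'I_k) :
  0 < lam i -> cone w i z ->
  det2 (w (ordS i) - w i) (vertex_map w lam i z - w i) < 0.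
Proof.
move=> l0 /cone_edge_left h.
have -> : det2 (w (ordS i) - w i) (vertex_map w lam i z - w i) =
    - (lam i * det2 (w (ordS i) - w i) (z - w i)).
  by rewrite !det2E /vertex_map mulNr !ReE !ImE; ring.
by rewrite oppr_lt0 mulr_gt0.
Qed.

Lemma billiard_in_cone (lam : 'I_k -> R) (z : R[i]) (i : 'I_k) : cone w i z ->
  exists2 j, cone w j z & billiard w lam z = vertex_map w lam j z.
Proof.
move=> ci; rewrite /billiard; case: pickP => [j /asboolP cj|/(_ i)].
  by exists j.
by move/asboolPn.
Qed.

(** As the image of a cone lies outside the polygon, non-singularity keeps the
    orbit inside the cones forever. *)
Lemma nonsingular_itinerary (lam : 'I_k -> R) (z : R[i]) :
  (forall i, 0 < lam i) -> nonsingular w lam z ->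
  exists s : nat -> 'I_k, forall n, let zn := iter n (billiard w lam) z in
    [/\ cone w (s n) zn, billiard w lam zn = vertex_map w lam (s n) zn &
        s n.+1 != s n].
Proof.
move=> l0 [ext ns].
have step n : exterior w (iter n (billiard w lam) z) -> exists i : 'I_k,
    cone w i (iter n (billiard w lam) z) /\
    iter n.+1 (billiard w lam) z = vertex_map w lam i (iter n (billiard w lam) z).
  move=> extn; have := ns n; rewrite /singular_set => h.
  have [i ci] : exists i, cone w i (iter n (billiard w lam) z).
    apply: contrapT => noi; apply: h; split=> // -[i _ ci].
    by apply: noi; exists i.
  by have [j cj ej] := billiard_in_cone lam ci; exists j.
have extn n : exterior w (iter n (billiard w lam) z).
  elim: n => [//|n /step[i [ci ->]]] /(polygon_edge_left i).
  by rewrite leNgt vertex_map_edge_right.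
have [s Hs] := choice (fun n => step n (extn n)).
exists s => n zn; have [cn en] := Hs n; split=> //.
apply/eqP => e; have [] := Hs n.+1; rewrite e en => /cone_edge_left.
by rewrite ltNge ltW // vertex_map_edge_right.
Qed.

End Convex.

Lemma unit_square_convex (R : realType) : convex_ccw (@unit_square R).
Proof.
split=> // i j; rewrite !det2E !ReE !ImE !Re_square !Im_square.
case: i => [[|[|[|[|]]]] // h]; case: j => [[|[|[|[|]]]] // h'];
  rewrite /= /modn /= ?eqE //= => _ _; lra.
Qed.

(** * Orbits with a prescribed sequence of vertices *)

Definition vertex_orbit (R : realType) (w : 'I_4 -> R[i]) (lam : 'I_4 -> R)
    (s : nat -> 'I_4) (z : nat -> R[i]) : Prop :=
  forall n, z n.+1 = vertex_map w lam (s n) (z n).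

Fixpoint vertex_iter (R : realType) (w : 'I_4 -> R[i]) (lam : 'I_4 -> R)
    (s : nat -> 'I_4) (z : R[i]) (n : nat) : R[i] :=
  if n is n'.+1 then vertex_map w lam (s n') (vertex_iter w lam s z n') else z.

(** The radius of a box that every orbit of every nearby polygon enters: the
    vertices have coordinates at most 2, so a step adds at most 4 to l' times
    the coordinates, with l' <= (1 + l) / 2. *)
Definition absorbing (R : realType) (l : R) : R := 8 / (1 - l) + 1.

Definition within (R : realType) (e : R) (z t : R[i]) : Prop :=
  `|complex.Re z - complex.Re t| <= e /\ `|complex.Im z - complex.Im t| <= e.

Lemma within_normc (R : realType) (e : R) (z t : R[i]) :
  within e z t -> Normc.normc (z - t) <= 2 * e.
Proof.
move=> [h1 h2]; apply: le_trans (normc_le_ReIm _) _.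
by rewrite Re_add Im_add Re_opp Im_opp; lra.
Qed.

Lemma both_eventually (P Q : nat -> Prop) :
  (exists N, forall n, (N <= n)%N -> P n) ->
  (exists N, forall n, (N <= n)%N -> Q n) ->
  exists N, forall n, (N <= n)%N -> P n /\ Q n.
Proof.
move=> [N HN] [N' HN']; exists (maxn N N') => n.
by rewrite geq_max => /andP[/HN hp /HN' hq].
Qed.

Section VertexOrbits.
Variables (R : realType) (l d : R) (w : 'I_4 -> R[i]) (lam : 'I_4 -> R).
Hypotheses (l01 : 0 < l < 1) (d01 : 0 <= d <= 1 / 16) (dl : d <= (1 - l) / 2).
Hypothesis near : near_square l d w lam.
Hypothesis lam0 : forall i, 0 < lam i.

Local Notation rho := ((1 + l) / 2).

Let rho01 : 0 <= rho < 1. Proof. by move: l01; lra. Qed.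

Let lam_rho i : lam i <= rho.
Proof. by have [_ _] := near i; rewrite ler_norml; move: dl; lra. Qed.

Lemma absorbing_ge1 : 1 <= absorbing l.
Proof.
move: l01 => /andP[? ?]; rewrite /absorbing lerDr; apply: divr_ge0; lra.
Qed.

Lemma affine_eventually_bounded (u : nat -> R) (W : nat -> R) (s : nat -> 'I_4) :
  (forall n, u n.+1 = - lam (s n) * u n + (1 + lam (s n)) * W n) ->
  (forall n, `|W n| <= 1 + d) ->
  exists N, forall n, (N <= n)%N -> `|u n| <= absorbing l.
Proof.
move=> Hu HW; apply: (@recursion_eventually_le R rho 4 _ (fun n => `|u n|) 0) => //.
  move: l01 => /andP[l0 l1]; rewrite /absorbing.
  have -> : (1 - rho) * (8 / (1 - l) + 1) = 4 + (1 - l) / 2 by field; lra.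
  lra.
move=> n _; rewrite Hu; apply: le_trans (ler_normD _ _) _; rewrite !normrM normrN.
have h0 := lam0 (s n); have h1 := lam_rho (s n).
rewrite (ger0_norm (ltW h0)) (ger0_norm (_ : 0 <= 1 + lam (s n))); last lra.
apply: lerD; first by rewrite ler_wpM2r.
have h2 : 1 + lam (s n) <= 2 by move: l01; lra.
have -> : 4 = 2 * 2 :> R by ring.
apply: ler_pM => //; first lra.
by apply: le_trans (HW n) _; move: d01; lra.
Qed.

Lemma vertex_norm i : `|complex.Re (w i)| <= 1 + d /\ `|complex.Im (w i)| <= 1 + d.
Proof.
have [] := near i; rewrite Re_square Im_square !ler_norml => h1 h2 _.
by move: d01 h1 h2; case: i => [[|[|[|[|]]]] // h] /=; lra.
Qed.

Lemma vertex_orbit_bounded s z : vertex_orbit w lam s z ->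
  exists N, forall n, (N <= n)%N ->
    `|complex.Re (z n)| <= absorbing l /\ `|complex.Im (z n)| <= absorbing l.
Proof.
move=> orb; apply: both_eventually.
  apply: (@affine_eventually_bounded _ (fun n => complex.Re (w (s n))) s).
    by move=> n; rewrite orb Re_vertex_map.
  by move=> n; have [] := vertex_norm (s n).
apply: (@affine_eventually_bounded _ (fun n => complex.Im (w (s n))) s).
  by move=> n; rewrite orb Im_vertex_map.
by move=> n; have [] := vertex_norm (s n).
Qed.

Lemma affine_contracting (e : R) (u v : nat -> R) (W : nat -> R) (s : nat -> 'I_4) N :
  0 < e ->
  (forall n, (N <= n)%N -> u n.+1 = - lam (s n) * u n + (1 + lam (s n)) * W n) ->
  (forall n, (N <= n)%N -> v n.+1 = - lam (s n) * v n + (1 + lam (s n)) * W n) ->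
  exists N, forall n, (N <= n)%N -> `|u n - v n| <= e.
Proof.
move=> e0 Hu Hv.
apply: (@recursion_eventually_le R rho 0 _ (fun n => `|u n - v n|) N) => //.
  by apply: mulr_gt0 => //; move: l01; lra.
move=> n Nn; rewrite Hu // Hv // addr0.
have -> : - lam (s n) * u n + (1 + lam (s n)) * W n -
  (- lam (s n) * v n + (1 + lam (s n)) * W n) = - (lam (s n) * (u n - v n)) by ring.
by rewrite normrN normrM (ger0_norm (ltW (lam0 _))) ler_wpM2r.
Qed.

Lemma vertex_orbits_asymptotic s (z t : nat -> R[i]) N (e : R) : 0 < e ->
  (forall n, (N <= n)%N -> z n.+1 = vertex_map w lam (s n) (z n)) ->
  (forall n, (N <= n)%N -> t n.+1 = vertex_map w lam (s n) (t n)) ->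
  exists N, forall n, (N <= n)%N -> within e (z n) (t n).
Proof.
move=> e0 Hz Ht; apply: both_eventually.
  apply: (@affine_contracting e _ _ (fun n => complex.Re (w (s n))) s N) => // n Nn.
    by rewrite Hz // Re_vertex_map.
  by rewrite Ht // Re_vertex_map.
apply: (@affine_contracting e _ _ (fun n => complex.Im (w (s n))) s N) => // n Nn.
  by rewrite Hz // Im_vertex_map.
by rewrite Ht // Im_vertex_map.
Qed.

Variable tau : R.
Hypothesis tau_small : d * (absorbing l + 4) < (1 - l) * tau.

(** Following the same vertices, the two maps differ by at most
    d (absorbing l + 4) on the box, and l contracts the accumulated error. *)
Lemma affine_shadow (u v : nat -> R) (W W0 : nat -> R) (s : nat -> 'I_4) N :
  (forall n, (N <= n)%N -> `|u n| <= absorbing l) ->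
  (forall n, u n.+1 = - lam (s n) * u n + (1 + lam (s n)) * W n) ->
  (forall n, v n.+1 = - l * v n + (1 + l) * W0 n) ->
  (forall n, `|W n| <= 1 + d) -> (forall n, `|W n - W0 n| <= d) ->
  exists N, forall n, (N <= n)%N -> `|u n - v n| <= tau.
Proof.
move=> Bu Hu Hv HW HW0; move: (l01) (d01) => /andP[l0 l1] /andP[d0 d1].
apply: (@recursion_eventually_le R l (d * (absorbing l + 4)) _
  (fun n => `|u n - v n|) N) => //; first by rewrite (ltW l0).
move=> n Nn; rewrite Hu // Hv //.
have -> : - lam (s n) * u n + (1 + lam (s n)) * W n - (- l * v n + (1 + l) * W0 n)
  = - (l * (u n - v n)) + ((lam (s n) - l) * (W n - u n) + (1 + l) * (W n - W0 n)).
  by ring.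
apply: le_trans (ler_normD _ _) _; rewrite normrN normrM (ger0_norm (ltW l0)).
rewrite lerD2l; apply: le_trans (ler_normD _ _) _; rewrite !normrM.
have [_ _ hl] := near (s n).
have h1 : `|W n - u n| <= 2 + absorbing l.
  apply: le_trans (ler_normB _ _) _.
  by have := HW n; have := Bu n Nn; lra.
have h2 : `|lam (s n) - l| * `|W n - u n| <= d * (2 + absorbing l) by apply: ler_pM.
have h3 : `|1 + l| * `|W n - W0 n| <= 2 * d.
  by apply: ler_pM => //; rewrite ger0_norm; lra.
lra.
Qed.

Lemma vertex_orbit_shadow s z y : vertex_orbit w lam s z ->
  vertex_orbit (@unit_square R) (fun=> l) s y ->
  exists N, forall n, (N <= n)%N -> within tau (z n) (y n).
Proof.
move=> orb orb0; have [N HN] := vertex_orbit_bounded orb.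
apply: both_eventually.
  apply: (@affine_shadow _ _ (fun n => complex.Re (w (s n)))
    (fun n => complex.Re (unit_square R (s n))) s N).
  - by move=> n /HN[].
  - by move=> n; rewrite orb Re_vertex_map.
  - by move=> n; rewrite orb0 Re_vertex_map.
  - by move=> n; have [] := vertex_norm (s n).
  - by move=> n; have [] := near (s n).
apply: (@affine_shadow _ _ (fun n => complex.Im (w (s n)))
  (fun n => complex.Im (unit_square R (s n))) s N).
- by move=> n /HN[].
- by move=> n; rewrite orb Im_vertex_map.
- by move=> n; rewrite orb0 Im_vertex_map.
- by move=> n; have [] := vertex_norm (s n).
- by move=> n; have [] := near (s n).
Qed.

Lemma chart_within (e : R) (i : 'I_4) (z t : R[i]) : within e z t ->
  sup_dist (chart i z) (chart i t) <= e.
Proof.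
move=> [h1 h2]; rewrite /sup_dist ge_max; move: h1 h2; rewrite !ler_norml.
by case: i => [[|[|[|[|]]]] // h] /=; lra.
Qed.

Lemma within_chart (e : R) (i : 'I_4) (z t : R[i]) :
  sup_dist (chart i z) (chart i t) <= e -> within e z t.
Proof.
rewrite /sup_dist ge_max => /andP[]; rewrite /within !ler_norml.
by case: i => [[|[|[|[|]]]] // h] /=; lra.
Qed.

Hypothesis d_small : d * (8 * absorbing l + 9) <= tau.
Hypothesis convex : convex_ccw w.
Hypothesis tau_l : 4 * tau < 1 - l ^+ 2.
Variable c : R.
Hypotheses (tau_c : 8 * tau < c) (c1 : c <= 1).
Hypothesis gap_c : forall m, c <= `|gap l m|.

Let tau0 : 0 < tau.
Proof.
have := absorbing_ge1; move: d01 tau_small l01 => /andP[h1 h2] h3 /andP[h4 h5] h6.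
have h : 0 <= d * (absorbing l + 4) by apply: mulr_ge0; lra.
have : 0 < (1 - l) * tau by lra.
by rewrite pmulr_rgt0 //; lra.
Qed.

(** The shadow of the orbit almost stays in the cones of the square, so its
    itinerary settles; and it has the itinerary of the orbit itself. *)
Lemma nonsingular_settles (z : R[i]) : nonsingular w lam z ->
  exists m j N, gap l m < 0 /\ forall n, (N <= n)%N ->
    iter n.+1 (billiard w lam) z =
    vertex_map w lam (cycle_index m (j + n)) (iter n (billiard w lam) z).
Proof.
move=> ns; have [s Hs] := nonsingular_itinerary convex lam0 ns.
pose zs n := iter n (billiard w lam) z.
have orb : vertex_orbit w lam s zs by move=> n; have [_ <-] := Hs n.
pose y := vertex_iter (@unit_square R) (fun=> l) s z.
have orb0 : vertex_orbit (@unit_square R) (fun=> l) s y by [].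
have [N HN] := both_eventually (vertex_orbit_bounded orb) (vertex_orbit_shadow orb orb0).
have quad n : (N <= n)%N ->
    - (2 * tau) <= (chart (s n) (y n)).1 /\ - (2 * tau) <= (chart (s n) (y n)).2.
  move=> /HN[[h1 h2] /(chart_within (s n))].
  have [cn _ _] := Hs n.
  have [h3 h4] := cone_chart near d01 absorbing_ge1 h1 h2 cn.
  rewrite /sup_dist ge_max !ler_norml => /andP[/andP[_ h5] /andP[_ h6]].
  by move: d_small; split; lra.
pose sg n := (s (N + n).+1 == (s (N + n)%N).+1 %% 4 :> nat)%N.
have turnE n : s (N + n).+1 = (s (N + n)%N + turn (sg n))%N %[mod 4].
  have [_ _ ne] := Hs (N + n)%N.
  apply: (@next_cone R l (2 * tau) _ _ (y (N + n)%N)) => //.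
  - by move: tau_l; have := exprn_gt0 2 (andP l01).1; lra.
  - by apply: quad; rewrite leq_addr.
  - by rewrite -orb0; apply: quad; apply: leqW; exact: leq_addr.
pose p n := chart (s (N + n)%N) (y (N + n)%N).
have porb n : p n.+1 = quadrant_map l (sg n) (p n).
  by rewrite /p addnS orb0; apply: chart_vertex_map.
have pquad n : - (2 * tau) <= (p n).1 /\ - (2 * tau) <= (p n).2.
  by apply: quad; rewrite leq_addr.
have [|||m [N' [g0 itin]]] := quadrant_orbit_settles l01 _ _ _ gap_c porb pquad.
- by move: tau0; lra.
- by move: tau_l; lra.
- by move: tau0 tau_c; lra.
(* The pattern starts at time N3, in a cone that the cycle meets at phase j. *)
pose N3 := (N + N')%N.
have [j Hj] := cycle_index_shift m (s N3).
have sE n : s (N3 + n)%N = (s N3 + cycle_index m n)%N %[mod 4].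
  elim: n => [|n IH]; first by rewrite cycle_indexE !addn0.
  have := turnE (N' + n)%N; rewrite itin !addnA -/N3 addnS => ->.
  by rewrite -modnDml IH modnDml -addnA -modnDmr -cycle_indexS modnDmr.
have sE' n : (N3 <= n)%N -> s n = cycle_index m (j + (n - N3))%N.
  move=> Nn; apply: val_inj; have := sE (n - N3)%N.
  by rewrite -Hj subnKC // !modn_small.
exists m, (j + (N3 * (4 * m.+1) - N3))%N, N3; split=> // n Nn.
have := orb n; rewrite {1}/zs sE' // => ->; congr (vertex_map _ _ _ _).
rewrite -(cycle_index_addM m (j + (n - N3)) N3); congr (cycle_index m _).
have := leq_pmulr N3 (isT : (0 < 4 * m.+1)%N).
move: (N3 * _)%N => Q; move: Nn; clear; lia.
Qed.

(** * Periodic orbits of nearby polygons *)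

(** The affine branches are defined everywhere, so they have a cycle for every
    m; the sign of the polynomial decides whether the billiard follows it. *)
Lemma vertex_cycle_exists m : exists x : nat -> R[i],
  vertex_orbit w lam (cycle_index m) x /\
  forall n, x (n + 4 * m.+1)%N = x n.
Proof.
pose beRe i := (1 + lam i) * complex.Re (w i).
pose beIm i := (1 + lam i) * complex.Im (w i).
pose al n := - lam (cycle_index m n).
have al_rho n : `|al n| <= rho by rewrite normrN (ger0_norm (ltW (lam0 _))).
have alP n : al (n + 4 * m.+1)%N = al n by rewrite /al cycle_index_periodic.
have P0 : (0 < 4 * m.+1)%N by [].
have [u [Hu uP]] := periodic_affine_orbit
  (be := fun n => beRe (cycle_index m n))
  rho01 P0 al_rho alP (fun n => congr1 beRe (cycle_index_periodic m n)).
have [v [Hv vP]] := periodic_affine_orbit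
  (be := fun n => beIm (cycle_index m n))
  rho01 P0 al_rho alP (fun n => congr1 beIm (cycle_index_periodic m n)).
exists (fun n => u n +i* v n); split=> n; last by rewrite uP vP.
by apply: eq_ReIm; rewrite ?Re_vertex_map ?Im_vertex_map; [exact: Hu|exact: Hv].
Qed.

Section Cycle.
Variables (m : nat) (x : nat -> R[i]).
Hypothesis orbx : vertex_orbit w lam (cycle_index m) x.
Hypothesis perx : forall n, x (n + 4 * m.+1)%N = x n.

Lemma vertex_cycle_addM n q : x (n + q * (4 * m.+1))%N = x n.
Proof.
elim: q => [|q IH]; first by rewrite mul0n addn0.
by rewrite mulSn addnCA addnC perx.
Qed.

Lemma vertex_cycle_bounded n :
  `|complex.Re (x n)| <= absorbing l /\ `|complex.Im (x n)| <= absorbing l.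
Proof.
have [N HN] := vertex_orbit_bounded orbx.
rewrite -(vertex_cycle_addM n N); apply: HN.
by apply: leq_trans (leq_addl _ _); rewrite leq_pmulr.
Qed.

(** What holds eventually along a cycle holds always, so the cycle shadows the
    limit of the unperturbed orbits with its itinerary. *)
Lemma vertex_cycle_close n :
  sup_dist (chart (cycle_index m n) (x n)) (quadrant_cycle l m n) <= 2 * tau.
Proof.
pose y := vertex_iter (@unit_square R) (fun=> l) (cycle_index m) (x 0).
have orb0 : vertex_orbit (@unit_square R) (fun=> l) (cycle_index m) y by [].
pose p k := chart (cycle_index m k) (y k).
have porb k : p k.+1 = quadrant_map l (m.+1 %| k.+1)%N (p k).
  by rewrite /p orb0; apply: chart_vertex_map; exact: cycle_indexS.
have [N HN] := both_eventually (vertex_orbit_shadow orbx orb0)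
  (quadrant_cycle_attracts l01 tau0 porb).
pose n' := (n + N * (4 * m.+1))%N.
have [] : within tau (x n') (y n') /\ sup_dist (p n') (quadrant_cycle l m n') <= tau.
  by apply: HN; apply: leq_trans (leq_addl _ _); rewrite leq_pmulr.
have -> : quadrant_cycle l m n' = quadrant_cycle l m n.
  by rewrite /quadrant_cycle /n' mulnA addnC modnMDl.
rewrite -(vertex_cycle_addM n N) -/n' -(cycle_index_addM m n N) -/n'.
move=> /(chart_within (cycle_index m n')); rewrite /sup_dist -/(p n') !ge_max.
move=> /andP[h1 h2] /andP[h3 h4]; apply/andP; split.
  by apply: le_trans (ler_distD (p n').1 _ _) _; lra.
by apply: le_trans (ler_distD (p n').2 _ _) _; lra.
Qed.

Hypothesis gap_neg : gap l m < 0.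

Lemma vertex_cycle_inside n :
  c / 2 - 2 * tau <= (chart (cycle_index m n) (x n)).1 /\
  c / 2 - 2 * tau <= (chart (cycle_index m n) (x n)).2.
Proof.
have c01 : 0 < c <= 1 by move: tau0 tau_c c1; lra.
have := quadrant_cycle_margin n l01 c01 (gap_c m) gap_neg.
have := vertex_cycle_close n; rewrite /sup_dist ge_max !ler_norml; lra.
Qed.

(** The margin of the unperturbed cycle exceeds the distance to it. *)
Lemma vertex_cycle_cone n : cone w (cycle_index m n) (x n).
Proof.
have [h1 h2] := vertex_cycle_bounded n.
apply: (chart_cone near d01 absorbing_ge1 _ h1 h2 (vertex_cycle_inside n)).
by move: d_small tau_c tau0; lra.
Qed.

Lemma vertex_cycle_cone_unique n j : cone w j (x n) -> cycle_index m n = j.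
Proof.
move=> cj; have [h1 h2] := vertex_cycle_bounded n.
have [h3 h4] := cone_chart near d01 absorbing_ge1 h1 h2 cj.
apply: (chart_separated (g := c / 2 - 2 * tau) (k := tau) _ _ _
  (vertex_cycle_inside n)); by move: d_small tau_c tau0 c1; lra.
Qed.

Lemma vertex_cycle_step n : billiard w lam (x n) = x n.+1.
Proof.
have [j cj ->] := billiard_in_cone lam (vertex_cycle_cone n).
by rewrite orbx (vertex_cycle_cone_unique cj).
Qed.

Lemma vertex_cycle_iter n q : iter q (billiard w lam) (x n) = x (n + q)%N.
Proof.
elim: q => [|q IH]; first by rewrite addn0.
by rewrite iterS IH vertex_cycle_step addnS.
Qed.

Lemma vertex_cycle_nonsingular n : nonsingular w lam (x n).
Proof.
split; first exact: (cone_exterior convex (vertex_cycle_cone n)).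
move=> q; rewrite vertex_cycle_iter => -[_]; apply.
by exists (cycle_index m (n + q)) => //; exact: vertex_cycle_cone.
Qed.

End Cycle.

(** The cycles of a polygon close to the square are those whose formal model
    lies in the quadrant, a condition that only involves the square. *)
Lemma near_square_cycle_system : exists C : nat -> nat -> R[i],
  cycle_system w lam [set m | gap l m < 0] (fun m => 4 * m.+1)%N C /\
  forall m n,
    sup_dist (chart (cycle_index m n) (C m n)) (quadrant_cycle l m n) <= 2 * tau.
Proof.
have [C HC] := choice vertex_cycle_exists.
exists C; split; last by move=> m n; apply: vertex_cycle_close; case: (HC m).
split=> //.
- by move=> m n g0; have [h1 h2] := HC m; exact: (vertex_cycle_nonsingular h1 h2).
- by move=> m n g0; have [h1 h2] := HC m; exact: (vertex_cycle_step h1 h2).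
- by move=> m n; have [_] := HC m.
- move=> m n m' n' g g' e; have [h1 h2] := HC m; have [h1' h2'] := HC m'.
  apply: cycle_index_inj => q.
  apply: (vertex_cycle_cone_unique h1 h2 g).
  rewrite -(vertex_cycle_iter h1 h2 g) e (vertex_cycle_iter h1' h2' g').
  exact: (vertex_cycle_cone h1' h2' g').
move=> z ns; have [m [j [N [g0 HN]]]] := nonsingular_settles ns.
exists m, j; split=> // e e0.
have e30 : 0 < e / 3 by lra.
have [h1 _] := HC m.
have [n0 Hn0] := @vertex_orbits_asymptotic (fun n => cycle_index m (j + n)%N)
  (fun n => iter n (billiard w lam) z) (fun n => C m (j + n)%N) N _ e30
  (fun n Nn => HN n Nn) (fun n _ => etrans (congr1 _ (addnS j n)) (h1 (j + n)%N)).
by exists n0 => n /Hn0 /within_normc; lra.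
Qed.

End VertexOrbits.

(** * Stability *)

Lemma coords_near_square (R : realType) (l d : R) (w : 'I_4 -> R[i])
    (lam : 'I_4 -> R) :
  w ord0 = 0 -> `|coords w lam - coords (@unit_square R) (fun=> l)| < d ->
  near_square l d w lam.
Proof.
move=> w0 hd i.
have entry j : `|coords w lam 0 j - coords (@unit_square R) (fun=> l) 0 j| <= d.
  apply: le_trans (ltW hd); rewrite [leRHS]mx_normrE.
  rewrite (_ : _ - _ = (coords w lam - coords (@unit_square R) (fun=> l)) 0 j).
    by apply: (le_bigmax _ _ (0, j)).
  by rewrite [RHS]mxE [X in _ = _ + X]mxE.
rewrite /coords in entry.
have d0 : 0 <= d by apply: le_trans (entry (rshift _ i)).
have hlam : `|lam i - l| <= d.
  by have := entry (rshift _ i); rewrite !row_mxEr !mxE.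
case: (unliftP ord0 i) hlam => [j ->|->] hlam; last first.
  by rewrite w0 !Re_square !Im_square /= subr0 normr0; split.
have := entry (lshift _ (lshift _ j)); have := entry (lshift _ (rshift _ j)).
by rewrite !row_mxEl !row_mxEr !mxE => h1 h2; split.
Qed.

Lemma square_near_square (R : realType) (l d : R) : 0 <= d ->
  near_square l d (@unit_square R) (fun=> l).
Proof. by move=> d0 i; rewrite !subrr normr0. Qed.

Theorem theorem6p1 (R : realType) (lambda : R)
    (lambda01 : 0 < lambda < 1) (lambda_notin : ~ @Lambda R lambda) :
  let w := @unit_square R in
  let lam := fun _ : 'I_4 => lambda in
  forall eps : R, 0 < eps ->
  exists2 delta : R, 0 < delta &
  forall (w' : 'I_4 -> R[i]) (lam' : 'I_4 -> R),
    P_space w' lam' -> `|coords w' lam' - coords w lam| < delta ->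
    [/\ asymptotically_periodic w' lam',
        (omega w' lam' #= omega w lam)%card,
        (hausdorff_dist (omega w' lam') (omega w lam) < eps%:E)%E &
        exists phi : set R[i] -> set R[i],
          set_bij (periodic_orbits w' lam') (periodic_orbits w lam) phi /\
          forall (p : nat) (O : set R[i]), periodic_orbits w' lam' O ->
            (orbit_of_period w' lam' p O <-> orbit_of_period w lam p (phi O))].
Proof.
move=> w lam eps eps0.
have [c /andP[c0 c1] gap_c] := gap_bounded_away lambda01 lambda_notin.
have /andP[l0 l1] := lambda01.
have B1 := absorbing_ge1 lambda01; set B := absorbing lambda in B1.
have l2 : 0 < 1 - lambda ^+ 2 by rewrite subr_gt0 expr_lt1 // ltW.
(* tau bounds the distance to shadows: small with respect to the margin c, to
   the slack 1 - l^2 in the comparison of blocks, and to eps. *)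
have [tau tau0 [tau_c tau_l tau_eps]] : exists2 tau, 0 < tau &
    [/\ 8 * tau < c, 4 * tau < 1 - lambda ^+ 2 & 8 * tau < eps].
  exists (Num.min (c / 16) (Num.min ((1 - lambda ^+ 2) / 8) (eps / 16))).
    by rewrite !lt_min !divr_gt0.
  set t := Num.min _ _.
  have [h1 [h2 h3]] : t <= c / 16 /\ t <= (1 - lambda ^+ 2) / 8 /\ t <= eps / 16.
    by rewrite /t !ge_min !lexx ?orbT.
  by split; lra.
have BB : 0 < 8 * B + 9 by lra.
(* d is such that polygons d-close to the square have tau-close shadows, and
   cones that are tau-close in the box. *)
have [d d0 [d_16 d_l d_B]] : exists2 d, 0 < d &
    [/\ d <= 1 / 16, d <= (1 - lambda) / 2 & d * (8 * B + 9) <= (1 - lambda) * tau].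
  have h0 : 0 < (1 - lambda) * tau / (8 * B + 9).
    by rewrite divr_gt0 // mulr_gt0 // subr_gt0.
  exists (Num.min (1 / 16) (Num.min ((1 - lambda) / 2)
    ((1 - lambda) * tau / (8 * B + 9)))).
    by rewrite !lt_min h0 andbT; lra.
  by rewrite -ler_pdivlMr // !ge_min !lexx ?orbT.
have d01 : 0 <= d <= 1 / 16 by rewrite ltW.
have dB : d * (B + 4) < (1 - lambda) * tau.
  by apply: lt_le_trans d_B; rewrite ltr_pM2l //; lra.
have dB' : d * (8 * B + 9) <= tau.
  by apply: le_trans d_B _; rewrite ler_piMl //; lra.
have [C [sys closeC]] := near_square_cycle_system lambda01 d01 d_l
  (square_near_square lambda (ltW d0)) (fun=> l0) dB dB' (@unit_square_convex R)
  tau_l tau_c c1 gap_c.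
exists d => // w' lam' [convex' w'0 lam'01] dist.
have lam'0 i : 0 < lam' i by have /andP[] := lam'01 i.
have [C' [sys' closeC']] := near_square_cycle_system lambda01 d01 d_l
  (coords_near_square w'0 dist) lam'0 dB dB' convex' tau_l tau_c c1 gap_c.
split.
- apply: (cycles_asymptotically_periodic sys').
  have [n0 Hn0] := gap_eventually lambda01.
  apply: (sub_finite_set _ (finite_II n0)) => m /= g0.
  by rewrite ltnNge; apply/negP => /Hn0; lra.
- exact: cycle_systems_omega_card sys sys'.
- apply: (@le_lt_trans _ _ (8 * tau)%:E); last by rewrite lte_fin.
  apply: (cycle_systems_hausdorff sys sys') => m n _.
  have -> : 8 * tau = 2 * (4 * tau) by ring.
  apply/within_normc/(@within_chart _ _ (cycle_index m n)).
  move: (closeC m n) (closeC' m n); rewrite /sup_dist !ge_max.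
  move=> /andP[h1 h2] /andP[h3 h4]; move: h1 h2 h3 h4; rewrite !ler_norml.
  lra.
- exact: cycle_systems_bij sys sys'.
Qed.
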